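(* Let $\Omega\subset\mathbb{R}^4$ be a bounded smooth domain, $\lambda_1,\lambda_2,\theta_1,\theta_2\in\mathbb{R}$ and $\mu_1,\mu_2>0$. Let $$\Sigma_2:=\{(\lambda,\mu,\theta):\theta<0,\ \mu>0,\ |\theta|+\theta\log|\theta|-\theta\log\mu+\lambda-\lambda_1(\Omega)\ge0\},$$ where $\lambda_1(\Omega)$ is the first eigenvalue of $-\Delta$ on $\Omega$ with Dirichlet boundary conditions. Assume that $(\lambda_1,\mu_1,\theta_1)\in\Sigma_2$ or $(\lambda_2,\mu_2,\theta_2)\in\Sigma_2$. If $\beta>0$, then the system $$-\Delta u=\lambda_1u+\mu_1|u|^2u+\beta|v|^2u+\theta_1u\log u^2,\quad -\Delta v=\lambda_2v+\mu_2|v|^2v+\beta|u|^2v+\theta_2v\log v^2\ \text{ in }\Omega,\quad u=v=0\ \text{ on }\partial\Omega$$ has no positive solutions.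
   Context: Solutions are weak solutions $(u,v)\in H_0^1(\Omega)\times H_0^1(\Omega)$; a solution $(u,v)$ is positive if both $u>0$ and $v>0$ in $\Omega$. *)

(* Defs.v *)
From HB Require Import structures.
From mathcomp Require Import all_boot all_order all_algebra.
From mathcomp Require Import all_classical all_reals all_analysis.

Set Implicit Arguments.
Unset Strict Implicit.
Unset Printing Implicit Defensive.

Import Order.TTheory GRing.Theory Num.Theory.
Import numFieldNormedType.Exports.

Local Open Scope classical_set_scope.
Local Open Scope ring_scope.

(* R^4 is an iterated product rather than 'rV[R]_4, because the library provides
   the product topology, sigma-algebra and measure for pairs but no Lebesgue
   measure on row vectors. The library norm on it is the max norm; only the
   induced topology and boundedness are used below. *)
Notation R4 R := (R * R * R * R)%type (only parsing).

(* The same type, equipped with the measurable structure that carries the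
   library's lebesgue_measure (Borel sets). *)
Notation mR4 R := (measurableTypeR R * measurableTypeR R * measurableTypeR R
                   * measurableTypeR R)%type (only parsing).

Section PDE4.
Context {R : realType}.
Implicit Types (Omega U : set (R4 R)) (i : 'I_4) (u v w phi f : R4 R -> R)
  (g h : 'I_4 -> R4 R -> R).

Definition leb4 : {measure set (mR4 R) -> \bar R} :=
  (((@lebesgue_measure R \x @lebesgue_measure R)
     \x @lebesgue_measure R) \x @lebesgue_measure R)%E.

Definition basis4 i : R4 R :=
  ((i == 0%N :> nat)%:R, (i == 1%N :> nat)%:R,
   (i == 2%N :> nat)%:R, (i == 3%N :> nat)%:R).

Definition pd i f : R4 R -> R := fun x => 'D_(basis4 i) f x.

Definition pds (s : seq 'I_4) f : R4 R -> R := foldr pd f s.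

(* C^oo on U (meant for U open): all partial derivatives of all orders exist
   and are continuous. The derivability clause is needed because 'D_v is a
   total operator. *)
Definition smooth_on U f : Prop :=
  forall (s : seq 'I_4) (x : R4 R), U x ->
    {for x, continuous (pds s f)} /\
    forall i, derivable (pds s f) x (basis4 i).

(* Near each boundary point, Omega is a sublevel set of a smooth function with
   nonzero gradient, i.e. (implicit function theorem) Omega lies on one side of
   a smooth hypersurface. *)
Definition smooth_boundary Omega : Prop :=
  forall x, (closure Omega `\` Omega) x ->
    exists (r : R) (rho : R4 R -> R),
      [/\ 0 < r, smooth_on (ball x r) rho,
          rho x = 0, (exists i, pd i rho x != 0) &
          Omega `&` ball x r = [set y | rho y < 0] `&` ball x r].

Definition bounded_smooth_domain Omega : Prop :=
  [/\ open Omega, connected Omega, Omega !=set0,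
      bounded_set Omega & smooth_boundary Omega].

(* C_c^oo(Omega), as functions on R^4 vanishing outside a compact subset of
   Omega. *)
Definition test_function Omega phi : Prop :=
  [/\ smooth_on setT phi, compact (closure [set x | phi x != 0]) &
      closure [set x | phi x != 0] `<=` Omega].

(* Elements of L^2(Omega) are represented by functions on R^4, of which only
   the restriction to Omega matters. *)
Definition L2 Omega f : Prop :=
  measurable_fun (Omega : set (mR4 R)) f /\
  (\int[leb4]_(x in Omega) (`|f x| ^+ 2)%:E < +oo)%E.

Definition weak_pd Omega i u w : Prop :=
  forall phi, test_function Omega phi ->
    (\int[leb4]_(x in Omega) (u x * pd i phi x)%:E =
     - \int[leb4]_(x in Omega) (w x * phi x)%:E)%E.

(* u is in H^1(Omega) and g is its weak gradient. *)
Definition H1 Omega u g : Prop :=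
  L2 Omega u /\ forall i, L2 Omega (g i) /\ weak_pd Omega i u (g i).

Definition H1_dist2 Omega u g v h : \bar R :=
  (\int[leb4]_(x in Omega) (`|u x - v x| ^+ 2)%:E +
   \sum_(i < 4) \int[leb4]_(x in Omega) (`|g i x - h i x| ^+ 2)%:E)%E.

(* u is in H^1_0(Omega), the closure of C_c^oo(Omega) in H^1(Omega), and g is
   its weak gradient. *)
Definition H10 Omega u g : Prop :=
  H1 Omega u g /\
  exists phi : nat -> R4 R -> R,
    (forall n, test_function Omega (phi n)) /\
    (fun n => H1_dist2 Omega u g (phi n) (fun i => pd i (phi n))) @ \oo --> 0%E.

(* u is in H^1_0(Omega) and is a weak solution of -Laplacian u = f in Omega,
   u = 0 on the boundary. The left-hand integral is always finite, so the
   equality of extended reals contains the integrability of f * phi over Omega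
   (the library's integral is infinite when the positive or the negative part
   has infinite integral). *)
Definition weak_dirichlet_solution Omega u f : Prop :=
  exists g, H10 Omega u g /\
    forall phi h, H10 Omega phi h ->
      (\int[leb4]_(x in Omega) (\sum_(i < 4) g i x * h i x)%R%:E =
       \int[leb4]_(x in Omega) (f x * phi x)%:E)%E.

Definition dirichlet_eigenvalue Omega (l : R) : Prop :=
  exists2 e : R4 R -> R,
    ~ {ae leb4, forall x, Omega x -> e x = 0} &
    weak_dirichlet_solution Omega e (fun x => l * e x).

Definition first_dirichlet_eigenvalue Omega (l : R) : Prop :=
  dirichlet_eigenvalue Omega l /\
  forall l', dirichlet_eigenvalue Omega l' -> l <= l'.

(* Sigma_2, with lO standing for the first eigenvalue; triples are
   (lambda, mu, theta). *)
Definition Sigma2 (lO : R) : set (R * R * R) :=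
  [set p | let: (lambda, mu, theta) := p in
    [/\ theta < 0, 0 < mu &
        0 <= `|theta| + theta * ln `|theta| - theta * ln mu + lambda - lO]].

(* The term u log u^2 vanishes where u = 0 (here ln 0 = 0). *)
Definition system_solution Omega (lambda1 lambda2 mu1 mu2 theta1 theta2 beta : R)
    u v : Prop :=
  weak_dirichlet_solution Omega u (fun x =>
    lambda1 * u x + mu1 * `|u x| ^+ 2 * u x + beta * `|v x| ^+ 2 * u x
    + theta1 * (u x * ln (u x ^+ 2))) /\
  weak_dirichlet_solution Omega v (fun x =>
    lambda2 * v x + mu2 * `|v x| ^+ 2 * v x + beta * `|u x| ^+ 2 * v x
    + theta2 * (v x * ln (v x ^+ 2))).

(* Functions are representatives of almost-everywhere classes, hence "ae". *)
Definition positive_in Omega u : Prop :=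
  {ae leb4, forall x, Omega x -> 0 < u x}.

End PDE4.

(* Main.v *)
From HB Require Import structures.
Require Import Defs.
From mathcomp Require Import all_boot all_order all_algebra.
From mathcomp Require Import all_classical all_reals all_analysis.
From mathcomp Require Import measurable_realfun.
From mathcomp Require Import ring lra.

Set Implicit Arguments.
Unset Strict Implicit.
Unset Printing Implicit Defensive.

Import Order.TTheory GRing.Theory Num.Theory.
Import numFieldNormedType.Exports.

Local Open Scope classical_set_scope.
Local Open Scope ring_scope.

(** Testing the equation against a first eigenfunction leads to a contradiction
    once this eigenfunction is known to be positive, which rests on the
    variational characterisation of lambda_1(Omega) and so on the compactness of
    the embedding of H^1_0 in L^2. Picone's inequality gives a shorter way, which
    works with any eigenfunction for lambda_1(Omega), whatever its sign.

    Say that the first triple is in Sigma_2, the other case being symmetric.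
    Minimising
    s |-> mu_1 s + theta_1 log s over s > 0, at s = |theta_1| / mu_1, shows that
    membership in Sigma_2 means
      lambda_1 + mu_1 s + theta_1 log s >= lambda_1(Omega)  for all s > 0
    ([Sigma2_le]). So a positive solution satisfies -Delta u = f with
    f >= V u, where V = lambda_1(Omega) + beta v^2. A positive supersolution
    forces the inequality
      int V w^2 <= int |grad w|^2  for all w in H^1_0(Omega)
    ([potential_energy_le]). For an eigenfunction w = e the right-hand side is
    lambda_1(Omega) int e^2, so beta int v^2 e^2 <= 0 and e = 0, which is
    absurd ([no_positive_solution]).

    The inequality is obtained by testing the equation of u with psi^2 / u, for
    a test function psi, since
      grad u . grad (psi^2 / u)
        = |grad psi|^2 - |grad psi - (psi / u) grad u|^2 <= |grad psi|^2.
    As psi^2 / u need not be admissible, 1 / u is replaced by a function G of u,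
    and then u itself by test functions phi_n that converge to u in H^1: the
    product psi^2 G(phi_n) is again a test function ([picone_test_pd]). The
    phi_n may be negative, so G must be smooth with bounded derivative on the
    whole line, while its Picone inequality is needed on the half-line t >= 0
    only, where it may lose a factor 1 - epsilon. The rational function
    [reg_inv] has these properties. The limit in n is dominated convergence
    ([defect_limit]), the limit in psi and epsilon is Fatou's lemma.

    About H^1_0 one needs to know that it contains the test functions, with
    their classical gradients ([H10_test]). This is integration by parts, hence
    Fubini's theorem and the fundamental theorem of calculus on lines. *)

(** * Integrals of real functions *)

Lemma normM_le_sqr_dist {R : realType} (q p s : R) :
  (q - p) ^+ 2 <= s -> `|q| * `|p| <= 2 * q ^+ 2 + s.
Proof.
move=> qps; rewrite -normrM ler_norml.
have := sqr_ge0 (2 * q - p); have := sqr_ge0 (2 * p - q).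
have := sqr_ge0 p; have := sqr_ge0 q.
by move=> *; apply/andP; split; nra.
Qed.

Lemma sqr_le_sqr_dist {R : realType} (q p s : R) :
  (q - p) ^+ 2 <= s -> p ^+ 2 <= 2 * q ^+ 2 + 2 * s.
Proof. by move=> qps; have := sqr_ge0 (2 * q - p); nra. Qed.

Section FastL2.
Context d (T : measurableType d) (R : realType) (mu : {measure set T -> \bar R}).
Variable D : set T.
Hypothesis mD : measurable D.

(** A sequence that converges fast in L^2 converges almost everywhere, and all
    its errors are dominated at once: both follow from the sum of the squared
    errors having a finite integral. *)
Lemma fast_L2_cvg (f : nat -> T -> R) (g : T -> R) :
  (forall n, measurable_fun D (f n)) -> measurable_fun D g ->
  (forall n, \int[mu]_(x in D) (`|g x - f n x| ^+ 2)%:E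
             <= (1 / (2 ^ (n + 1))%:R)%:E)%E ->
  exists S : T -> R,
    [/\ mu.-integrable D (EFin \o S), forall x, D x -> 0 <= S x,
        {ae mu, forall x, D x -> forall n, (g x - f n x) ^+ 2 <= S x} &
        {ae mu, forall x, D x -> f ^~ x @ \oo --> g x}].
Proof.
move=> mf mg fg.
pose h (n : nat) (x : T) : \bar R := ((g x - f n x) ^+ 2)%:E.
have h0 n x : D x -> (0 <= h n x)%E by rewrite lee_fin sqr_ge0.
have mh n : measurable_fun D (h n).
  by apply/measurable_EFinP/measurable_funX/measurable_funB.
pose S (x : T) : \bar R := (\sum_(0 <= n <oo) h n x)%E.
have mS : measurable_fun D S.
  by apply: (@ge0_emeasurable_sum _ _ _ D h xpredT) => // k x Dx _; exact: h0.
have S0 x : D x -> (0 <= S x)%E.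
  by move=> Dx; apply: nneseries_ge0 => n _ _; exact: h0.
have hS n x : D x -> (h n x <= S x)%E.
  move=> Dx; rewrite /S (@nneseriesD1 _ _ n xpredT) //=; last by move=> k _; exact: h0.
  by rewrite leeDl// nneseries_ge0 // => k _ _; exact: h0.
have iS : mu.-integrable D S.
  apply/integrableP; split => //.
  rewrite (eq_integral S); last by move=> x; rewrite inE => Dx; rewrite gee0_abs ?S0.
  rewrite integral_nneseries//.
  apply: (@le_lt_trans _ _ (\sum_(0 <= n <oo) (1 / (2 ^ (n + 1))%:R)%:E)%E).
    apply: lee_nneseries => [n _ _|n _]; first by apply: integral_ge0 => x; exact: h0.
    have := fg n; congr (_ <= _)%E.
    by apply: eq_integral => x _; rewrite real_normK // num_real.
  have /cvg_lim := @cvg_geometric_eseries_half R 1 0.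
  by rewrite /eseries /= => -> //; rewrite ltry.
exists (fine \o S); split.
- apply: (le_integrable mD _ _ iS).
    by apply/measurable_EFinP; exact: measurableT_comp.
  by move=> x _ /=; case: (S x) => [r||] //=; rewrite normr0 ?leey.
- by move=> x Dx; exact/fine_ge0/S0.
- have := integrable_ae mD iS; apply: filterS => x Sfin Dx n.
  by rewrite -lee_fin /= fineK ?Sfin//; exact: hS.
have := integrable_ae mD iS; apply: filterS => x Sfin Dx.
have {}Sfin := Sfin Dx.
have cS : cvgn (series (fun n => (g x - f n x) ^+ 2)).
  apply: nondecreasing_is_cvgn.
    by apply/nondecreasing_seqP => n; rewrite /series/= big_nat_recr//= lerDl sqr_ge0.
  exists (fine (S x)) => _ [n _ <-].
  rewrite -lee_fin fineK // /series /= -sumEFin.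
  by apply: nneseries_lim_ge => k _ _; exact: h0.
have c2 : (fun n => (g x - f n x) ^+ 2) @ \oo --> (0 : R) by exact: cvg_series_cvg_0 cS.
have : (fun n => Num.sqrt ((g x - f n x) ^+ 2)) @ \oo --> Num.sqrt (0 : R).
  by apply: (cvg_comp _ _ c2); exact: sqrt_continuous.
rewrite sqrtr0; under eq_fun do rewrite sqrtr_sqr.
move/norm_cvg0P => c0; rewrite -[g x]subr0.
rewrite (_ : f ^~ x = fun n => g x - (g x - f n x)).
  by apply: cvgB c0; exact: cvg_cst.
by apply/funext => n; rewrite subKr.
Qed.
End FastL2.

Section RealIntegrals.
Context d (T : measurableType d) (R : realType) (mu : {measure set T -> \bar R}).
Variable D : set T.
Hypothesis mD : measurable D.

Lemma ae_le_integral (A B : T -> R) : measurable_fun D A ->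
  (forall x, D x -> 0 <= A x) -> mu.-integrable D (EFin \o B) ->
  {ae mu, forall x, D x -> A x <= B x} ->
  (\int[mu]_(x in D) (A x)%:E <= \int[mu]_(x in D) (B x)%:E)%E.
Proof.
move=> mA A0 iB AB.
have mB := measurable_int mu iB.
have -> : (\int[mu]_(x in D) (B x)%:E = \int[mu]_(x in D) `|(B x)%:E|)%E.
  apply: ae_eq_integral => //; first exact: measurableT_comp.
  move: AB; apply: filterS => x AB Dx.
  by rewrite gee0_abs// lee_fin (le_trans (A0 x Dx))// AB.
apply: ae_ge0_le_integral => //.
- exact/measurable_EFinP.
- exact: measurableT_comp.
- move: AB; apply: filterS => x AB Dx.
  by rewrite lee_fin (le_trans (AB Dx))// ler_norm.
Qed.

(** The form of Fatou's lemma that passes a convergent bound on the integrals to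
    an almost everywhere limit. *)
Lemma fatou_ae (F : nat -> T -> R) (G : T -> R) (b : nat -> \bar R) (l : \bar R) :
  (forall n, measurable_fun D (F n)) -> measurable_fun D G ->
  (forall n x, D x -> 0 <= F n x) -> (forall x, D x -> 0 <= G x) ->
  {ae mu, forall x, D x -> F ^~ x @ \oo --> G x} ->
  (forall n, \int[mu]_(x in D) (F n x)%:E <= b n)%E -> b @ \oo --> l ->
  (\int[mu]_(x in D) (G x)%:E <= l)%E.
Proof.
move=> mF mG F0 G0 FG Fb bl.
have mFE n : measurable_fun D (fun x => (F n x)%:E) by exact/measurable_EFinP.
have mL : measurable_fun D (fun x => limn_einf (fun n => (F n x)%:E)).
  apply: measurableT_comp => //.
  by apply: measurable_fun_limn_esup => n; exact: measurableT_comp.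
have -> : (\int[mu]_(x in D) (G x)%:E =
           \int[mu]_(x in D) limn_einf (fun n => (F n x)%:E))%E.
  apply: ae_eq_integral => //; first exact/measurable_EFinP.
  move: FG; apply: filterS => x FG Dx.
  have cFG : (fun n => (F n x)%:E) @ \oo --> (G x)%:E.
    by apply: cvg_EFin; [exact: nearW|exact: FG].
  rewrite is_cvg_limn_einfE; last by apply/cvg_ex; eexists; exact: cFG.
  by apply/esym/cvg_lim => //; exact: cFG.
apply: (le_trans (fatou mu mD mFE _)) => [n x Dx|]; first by rewrite lee_fin F0.
rewrite -(cvg_lim _ bl)// -is_cvg_limn_einfE; last by apply/cvg_ex; exists l.
rewrite !limn_einf_lim; apply: lee_lim.
- exact: is_cvg_einfs.
- exact: is_cvg_einfs.
- apply: nearW => n; apply: le_ereal_inf_tmp => _ [m /= nm <-].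
  apply: le_trans (Fb m); apply: ereal_inf_lbound; by exists m.
Qed.

Lemma integrable_sqr (f : T -> R) : measurable_fun D f ->
  (\int[mu]_(x in D) (`|f x| ^+ 2)%:E < +oo)%E ->
  mu.-integrable D (fun x => (f x ^+ 2)%:E).
Proof.
move=> mf f2; apply/integrableP; split.
  exact/measurable_EFinP/measurable_funX.
rewrite (eq_integral (fun x => (`|f x| ^+ 2)%:E))// => x _.
by rewrite gee0_abs ?lee_fin ?sqr_ge0// real_normK ?num_real.
Qed.

Lemma integrableM_bounded (f g : T -> R) (C : R) :
  mu.-integrable D (EFin \o f) -> measurable_fun D g ->
  (forall x, D x -> `|g x| <= C) -> mu.-integrable D (fun x => (f x * g x)%:E).
Proof.
move=> fi mg gC; have mf : measurable_fun D f.
  by apply/measurable_EFinP; exact: measurable_int fi.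
apply: (le_integrable mD _ _ (integrableZl mD C fi)).
  by apply/measurable_EFinP; exact: measurable_funM.
move=> x Dx /=; rewrite lee_fin !normrM mulrC ler_wpM2r//.
by rewrite (le_trans (gC x Dx))// ler_norm.
Qed.

Lemma integrableD_EFin (f g : T -> R) : mu.-integrable D (EFin \o f) ->
  mu.-integrable D (EFin \o g) -> mu.-integrable D (fun x => (f x + g x)%:E).
Proof. by move=> fi gi; exact: (integrableD mD fi gi). Qed.

Lemma integrableB_EFin (f g : T -> R) : mu.-integrable D (EFin \o f) ->
  mu.-integrable D (EFin \o g) -> mu.-integrable D (fun x => (f x - g x)%:E).
Proof. by move=> fi gi; exact: (integrableB mD fi gi). Qed.

Lemma integrableZ_EFin (k : R) (f : T -> R) : mu.-integrable D (EFin \o f) ->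
  mu.-integrable D (fun x => (k * f x)%:E).
Proof. by move=> fi; exact: (integrableZl mD k fi). Qed.

Lemma integrable_norm_EFin (f : T -> R) : mu.-integrable D (EFin \o f) ->
  mu.-integrable D (fun x => `|f x|%:E).
Proof. by move=> fi; exact: (integrable_abse fi). Qed.

Lemma integrable_sum_EFin (I : finType) (f : I -> T -> R) :
  (forall i, mu.-integrable D (EFin \o f i)) ->
  mu.-integrable D (fun x => (\sum_i f i x)%:E).
Proof.
move=> fi; under eq_fun do rewrite -sumEFin.
by apply: (integrable_sum mD) => i _; exact: fi.
Qed.

Lemma integrable_L2 (f : T -> R) : (mu D < +oo)%E -> measurable_fun D f ->
  (\int[mu]_(x in D) (`|f x| ^+ 2)%:E < +oo)%E -> mu.-integrable D (EFin \o f).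
Proof.
move=> Dfin mf f2.
have i1 : mu.-integrable D (EFin \o cst (1 : R)).
  apply: measurable_bounded_integrable => //; exists 1; split; first exact: num_real.
  by move=> M M1 x _; rewrite /= normr1 ltW.
apply: (le_integrable mD _ _ (integrableD mD i1 (integrable_sqr mf f2))).
  exact/measurable_EFinP.
move=> x Dx /=; rewrite lee_fin [leRHS]ger0_norm ?addr_ge0 ?sqr_ge0//.
by rewrite -(real_normK (num_real (f x))); have := sqr_ge0 (`|f x| - 1); nra.
Qed.

Lemma ae_eq0_of_integral_le0 (A : T -> R) :
  measurable_fun D A -> (forall x, D x -> 0 <= A x) ->
  (\int[mu]_(x in D) (A x)%:E <= 0)%E ->
  {ae mu, forall x, D x -> A x = 0}.
Proof.
move=> mA A0 A1.
have I0 : (\int[mu]_(x in D) `|(A x)%:E| = 0)%E.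
  apply/eqP; rewrite eq_le; apply/andP; split; last by apply: integral_ge0.
  apply: le_trans A1; rewrite le_eqVlt; apply/orP; left; apply/eqP.
  by apply: eq_integral => x; rewrite inE => Dx; rewrite gee0_abs// lee_fin A0.
have mAE : measurable_fun D (EFin \o A) by exact/measurable_EFinP.
have := (ae_eq_integral_abs mu mD mAE).1 I0.
by apply: filterS => x + Dx => /(_ Dx) [].
Qed.

End RealIntegrals.

(** * Borel sets of R^4 *)

Section CountableBase.

(** [M] contains a countable base of neighbourhoods: the property that passes
    to products and makes every open set a countable union of members of
    [M]. *)
Definition has_countable_base {X : topologicalType} (M : set (set X)) : Prop :=
  exists B : nat -> set X, (forall n, M (B n)) /\
    forall x (A : set X), nbhs x A -> exists2 n, B n x & B n `<=` A.

Lemma has_countable_baseX {X Y : topologicalType} (MX : set (set X))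
    (MY : set (set Y)) (M : set (set (X * Y)%type)) :
  (forall A B, MX A -> MY B -> M (A `*` B)) ->
  has_countable_base MX -> has_countable_base MY -> has_countable_base M.
Proof.
move=> MXY [BX [mBX nBX]] [BY [mBY nBY]].
exists (fun n => if @unpickle (nat * nat)%type n is Some p
                 then BX p.1 `*` BY p.2 else BX 0%N `*` BY 0%N).
split=> [n|[x y] A [[P Q] /= [xP yQ] PQA]].
  by case: unpickle => [[i j]|]; apply: MXY.
have [i xi iP] := nBX _ _ xP; have [j yj jQ] := nBY _ _ yQ.
exists (pickle (i, j)); rewrite pickleK //= => -[a b] [/= ia jb].
by apply: PQA; split; [exact: iP | exact: jQ].
Qed.

Lemma open_in_sigma {X : topologicalType} {M : set (set X)} :
  M set0 -> (forall F : nat -> set X, (forall n, M (F n)) -> M (\bigcup_n F n)) ->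
  has_countable_base M -> forall A, open A -> M A.
Proof.
move=> M0 MU [B [mB nB]] A oA.
have -> : A = \bigcup_n (if `[< B n `<=` A >] then B n else set0).
  apply/seteqP; split=> [x Ax|x [n _]]; last by case: asboolP => // BA /BA.
  have [|n Bx BA] := nB x A; first exact: open_nbhs_nbhs.
  by exists n => //; case: asboolP.
by apply: MU => n; case: ifP.
Qed.

End CountableBase.

Section R4measure.
Context {R : realType}.
Notation mR := (measurableTypeR R).

Lemma has_countable_baseR :
  has_countable_base (@measurable _ mR : set (set R)).
Proof.
exists (fun n => if @unpickle (rat * rat)%type n is Some p
                 then `]ratr p.1, ratr p.2[%classic else set0).
split=> [n|x A]; first by case: unpickle => [p|]; [exact: measurable_itv|].
rewrite -filter_from_ballE => -[e /= e0 xA].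
have [p] := @rat_in_itvoo R (x - e) x ltac:(by rewrite ltrBlDr ltrDl).
rewrite in_itv/= => /andP[p1 p2].
have [q] := @rat_in_itvoo R x (x + e) ltac:(by rewrite ltrDl).
rewrite in_itv/= => /andP[q1 q2].
exists (pickle (p, q)); rewrite pickleK /= ?in_itv/= ?p2// => y.
rewrite /= in_itv/= => /andP[y1 y2]; apply: xA.
rewrite /ball/= ltr_norml ltrBlDr ltrBrDl.
by apply/andP; split; lra.
Qed.

Lemma has_countable_base2 :
  has_countable_base (@measurable _ (mR * mR)%type : set (set (R * R))).
Proof.
by apply: has_countable_baseX has_countable_baseR has_countable_baseR => A B;
  exact: (@measurableX _ _ mR mR).
Qed.

Lemma has_countable_base3 :
  has_countable_base (@measurable _ (mR * mR * mR)%type : set (set (R * R * R))).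
Proof.
by apply: has_countable_baseX has_countable_base2 has_countable_baseR => A B;
  exact: (@measurableX _ _ (mR * mR)%type mR).
Qed.

Lemma has_countable_base4 :
  has_countable_base (@measurable _ (mR4 R) : set (set (R4 R))).
Proof.
by apply: has_countable_baseX has_countable_base3 has_countable_baseR => A B;
  exact: (@measurableX _ _ (mR * mR * mR)%type mR).
Qed.

Lemma open_measurable2 (A : set (R * R)%type) : open A -> measurable (A : set (mR * mR)%type).
Proof.
apply: (open_in_sigma _ _ has_countable_base2); first exact: measurable0.
exact: bigcupT_measurable.
Qed.

Lemma continuous_measurable2 (f : (R * R)%type -> R) :
  continuous f -> measurable_fun setT (f : (mR * mR)%type -> R).
Proof.
move=> cf; apply: (measurability _ (RGenOpens.measurableE R)).
move=> _ [_ [a [b ->]] <-]; rewrite setTI; apply: open_measurable2.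
by apply: open_comp; [move=> x _; exact: cf | exact: interval_open].
Qed.

Lemma open_measurable3 (A : set (R * R * R)%type) :
  open A -> measurable (A : set (mR * mR * mR)%type).
Proof.
apply: (open_in_sigma _ _ has_countable_base3); first exact: measurable0.
exact: bigcupT_measurable.
Qed.

Lemma continuous_measurable3 (f : (R * R * R)%type -> R) :
  continuous f -> measurable_fun setT (f : (mR * mR * mR)%type -> R).
Proof.
move=> cf; apply: (measurability _ (RGenOpens.measurableE R)).
move=> _ [_ [a [b ->]] <-]; rewrite setTI; apply: open_measurable3.
by apply: open_comp; [move=> x _; exact: cf | exact: interval_open].
Qed.

Lemma open_measurable4 (A : set (R4 R)) : open A -> measurable (A : set (mR4 R)).
Proof.
apply: (open_in_sigma _ _ has_countable_base4); first exact: measurable0.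
exact: bigcupT_measurable.
Qed.

Lemma continuous_measurable4 (f : (R4 R) -> R) :
  continuous f -> measurable_fun setT (f : (mR4 R) -> R).
Proof.
move=> cf; apply: (measurability _ (RGenOpens.measurableE R)).
move=> _ [_ [a [b ->]] <-]; rewrite setTI; apply: open_measurable4.
by apply: open_comp; [move=> x _; exact: cf | exact: interval_open].
Qed.

End R4measure.

(** * Product measures and iterated integrals *)

Section ProductMeasure.
Context {d1 d2 : measure_display} {T1 : measurableType d1} {T2 : measurableType d2}
  {R : realType}.
Variables (m1 : {sigma_finite_measure set T1 -> \bar R})
  (m2 : {sigma_finite_measure set T2 -> \bar R}).

Lemma product_measure_lty (A : set T1) (B : set T2) :
  measurable A -> measurable B -> (m1 A < +oo)%E -> (m2 B < +oo)%E ->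
  ((m1 \x m2) (A `*` B) < +oo)%E.
Proof.
move=> mA mB A1 B1; rewrite product_measure1E//.
by rewrite lte_mul_pinfty// ge0_fin_numE.
Qed.

Lemma product_sigma_finite : sigma_finite setT (m1 \x m2)%E.
Proof.
have /sigma_finiteP[F [TF ndF Foo]] := sigma_finiteT m1.
have /sigma_finiteP[G [TG ndG Goo]] := sigma_finiteT m2.
exists (fun n => F n `*` G n) => [|k].
  apply/seteqP; split=> // -[x y] _.
  have [n _ Fx] : (\bigcup_n F n) x by rewrite -TF.
  have [k _ Gy] : (\bigcup_n G n) y by rewrite -TG.
  exists (maxn n k) => //; split.
    by move: x Fx; exact/subsetPset/ndF/leq_maxl.
  by move: y Gy; exact/subsetPset/ndG/leq_maxr.
have [mF Ffin] := Foo k; have [mG Gfin] := Goo k.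
by split; [exact: measurableX|exact: product_measure_lty].
Qed.

Lemma integral_prod_eq0l (f : T1 * T2 -> \bar R) :
  (m1 \x m2)%E.-integrable setT f ->
  (forall y, \int[m1]_x f (x, y) = 0)%E -> (\int[m1 \x m2]_z f z = 0)%E.
Proof.
move=> fi f0; rewrite -(integral21_prod_meas1 fi).
by apply: integral0_eq => y _; exact: f0.
Qed.

Lemma integral_prod_eq0r (f : T1 * T2 -> \bar R) :
  (m1 \x m2)%E.-integrable setT f ->
  (forall x, \int[m2]_y f (x, y) = 0)%E -> (\int[m1 \x m2]_z f z = 0)%E.
Proof.
move=> fi f0; rewrite -(integral12_prod_meas1 fi).
by apply: integral0_eq => x _; exact: f0.
Qed.

End ProductMeasure.

Lemma bounded_support_integrable d (T : measurableType d) (R : realType)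
    (mu : {measure set T -> \bar R}) (A : set T) (f : T -> R) (C : R) :
  measurable A -> (mu A < +oo)%E -> measurable_fun setT f ->
  (forall x, `|f x| <= C) -> (forall x, ~ A x -> f x = 0) ->
  mu.-integrable setT (EFin \o f).
Proof.
move=> mA Afin mf fC fA.
have -> : EFin \o f = (EFin \o f) \_ A.
  apply/funext => x; rewrite patchE; case: ifPn => //.
  by rewrite notin_setE => /fA /= ->.
rewrite -integrable_mkcond//.
apply: measurable_bounded_integrable => //; first exact: measurable_funTS.
exists C; split; first exact: num_real.
by move=> M CM x _; exact: le_trans (fC x) (ltW CM).
Qed.

Section ContinuousBoundedSupport.
Context {R : realType}.
Notation mR := (measurableTypeR R).

Definition leb1 : {sigma_finite_measure set mR -> \bar R} := @lebesgue_measure R.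
Definition leb2 : set (mR * mR)%type -> \bar R := (leb1 \x leb1)%E.
HB.instance Definition _ := Measure.on leb2.
HB.instance Definition _ := Measure_isSigmaFinite.Build _ _ _ leb2
  (product_sigma_finite leb1 leb1).

Definition leb3 : set (mR * mR * mR)%type -> \bar R := (leb2 \x leb1)%E.
HB.instance Definition _ := Measure.on leb3.
HB.instance Definition _ := Measure_isSigmaFinite.Build _ _ _ leb3
  (product_sigma_finite leb2 leb1).

(** The functions to which Fubini's theorem is applied repeatedly: unlike mere
    integrability, this property passes to every section. *)
Definition cont_bdd_supp {V : normedModType R} (f : V -> R) : Prop :=
  [/\ continuous f, exists C, forall x, `|f x| <= C &
      exists M, forall x, M < `|x| -> f x = 0].

Lemma cont_bdd_supp_section {V W : normedModType R} (f : V * W -> R) y :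
  cont_bdd_supp f -> cont_bdd_supp (fun x => f (x, y)).
Proof.
case=> cf [C fC] [M fM]; split; [|by exists C => x|].
  move=> x; apply: (continuous_comp _ (cf (x, y))).
  by apply: cvg_pair; [exact: cvg_id|exact: cvg_cst].
by exists M => x Mx; apply: fM; rewrite prod_normE /= lt_max Mx.
Qed.

Lemma normed_ballX (V W : normedModType R) (M : R) :
  [set z : V * W | `|z| <= M] = [set x | `|x| <= M] `*` [set y | `|y| <= M].
Proof.
apply/seteqP; split=> -[x y] /=; rewrite prod_normE /= ge_max.
  by move=> /andP.
by move=> [-> ->].
Qed.

Lemma ball1_measure_lty (M : R) :
  let B := [set x : R | `|x| <= M] in
  measurable (B : set mR) /\ (leb1 B < +oo)%E.
Proof.
move=> B; have -> : B = `[- M, M]%classic.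
  by apply/seteqP; split=> x; rewrite /B /= in_itv /= ler_norml.
split; first exact: measurable_itv.
rewrite /leb1/= lebesgue_measure_itv /=; by case: ifP => _; rewrite ?ltry.
Qed.

Lemma ball2_measure_lty (M : R) :
  let B := [set x : R * R | `|x| <= M] in
  measurable (B : set (mR * mR)%type) /\ (leb2 B < +oo)%E.
Proof.
have [m1 f1] := ball1_measure_lty M; rewrite /= normed_ballX; split.
  exact: (@measurableX _ _ mR mR).
exact: (@product_measure_lty _ _ mR mR R leb1 leb1).
Qed.

Lemma ball3_measure_lty (M : R) :
  let B := [set x : R * R * R | `|x| <= M] in
  measurable (B : set (mR * mR * mR)%type) /\ (leb3 B < +oo)%E.
Proof.
have [m1 f1] := ball1_measure_lty M; have [m2 f2] := ball2_measure_lty M.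
rewrite /= normed_ballX; split.
  exact: (@measurableX _ _ (mR * mR)%type mR).
exact: (@product_measure_lty _ _ (mR * mR)%type mR R leb2 leb1).
Qed.

Lemma ball4_measure_lty (M : R) :
  let B := [set x : R4 R | `|x| <= M] in
  measurable (B : set (mR4 R)) /\ (leb4 B < +oo)%E.
Proof.
have [m1 f1] := ball1_measure_lty M; have [m3 f3] := ball3_measure_lty M.
rewrite /= normed_ballX; split.
  exact: (@measurableX _ _ (mR * mR * mR)%type mR).
exact: (@product_measure_lty _ _ (mR * mR * mR)%type mR R leb3 leb1).
Qed.

Lemma cont_bdd_supp_integrable2 (f : R * R -> R) : cont_bdd_supp f -> leb2.-integrable setT (EFin \o f).
Proof.
case=> /continuous_measurable2 mf [C fC] [M fM]; have [mB Bf] := ball2_measure_lty M.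
apply: bounded_support_integrable mB Bf mf fC _ => x /negP.
by rewrite -ltNge => /fM.
Qed.

Lemma cont_bdd_supp_integrable3 (f : R * R * R -> R) :
  cont_bdd_supp f -> leb3.-integrable setT (EFin \o f).
Proof.
case=> /continuous_measurable3 mf [C fC] [M fM]; have [mB Bf] := ball3_measure_lty M.
apply: bounded_support_integrable mB Bf mf fC _ => x /negP.
by rewrite -ltNge => /fM.
Qed.

Lemma cont_bdd_supp_integrable4 (f : R4 R -> R) :
  cont_bdd_supp f -> leb4.-integrable setT (EFin \o f).
Proof.
case=> /continuous_measurable4 mf [C fC] [M fM]; have [mB Bf] := ball4_measure_lty M.
apply: bounded_support_integrable mB Bf mf fC _ => x /negP.
by rewrite -ltNge => /fM.
Qed.

(** Only one of the four iterated integrals has to vanish, so that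
    Fubini's theorem is used in the order that integrates in that variable
    first. *)
Lemma integral4_eq0 (i : 'I_4) (f : R4 R -> R) : cont_bdd_supp f ->
  (forall x : R4 R, \int[leb1]_t (f (x + (t *: basis4 i)%R))%:E = 0)%E ->
  (\int[leb4]_x (f x)%:E = 0)%E.
Proof.
move=> cf f0.
have bE (a b c e t : R) : (a, b, c, e) + t *: basis4 i =
  (a + t * (i == 0%N :> nat)%:R, b + t * (i == 1%N :> nat)%:R,
   c + t * (i == 2%N :> nat)%:R, e + t * (i == 3%N :> nat)%:R) by [].
case: i f0 bE => -[|[|[|[|//]]]] i4 /= f0 bE.
- apply: (integral_prod_eq0l (m1 := leb3) (m2 := leb1)
    (cont_bdd_supp_integrable4 cf)) => e /=.
  have cf3 := cont_bdd_supp_section e cf.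
  apply: (integral_prod_eq0l (cont_bdd_supp_integrable3 cf3)) => c /=.
  have cf2 := cont_bdd_supp_section c cf3.
  apply: (integral_prod_eq0l (cont_bdd_supp_integrable2 cf2)) => b /=.
  rewrite -(f0 (0, b, c, e)); apply: eq_integral => t _.
  by rewrite bE !mulr0 !addr0 add0r mulr1.
- apply: (integral_prod_eq0l (m1 := leb3) (m2 := leb1)
    (cont_bdd_supp_integrable4 cf)) => e /=.
  have cf3 := cont_bdd_supp_section e cf.
  apply: (integral_prod_eq0l (cont_bdd_supp_integrable3 cf3)) => c /=.
  have cf2 := cont_bdd_supp_section c cf3.
  apply: (integral_prod_eq0r (cont_bdd_supp_integrable2 cf2)) => a /=.
  rewrite -(f0 (a, 0, c, e)); apply: eq_integral => t _.
  by rewrite bE !mulr0 !addr0 add0r mulr1.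
- apply: (integral_prod_eq0l (m1 := leb3) (m2 := leb1)
    (cont_bdd_supp_integrable4 cf)) => e /=.
  have cf3 := cont_bdd_supp_section e cf.
  apply: (integral_prod_eq0r (cont_bdd_supp_integrable3 cf3)) => -[a b] /=.
  rewrite -(f0 (a, b, 0, e)); apply: eq_integral => t _.
  by rewrite bE !mulr0 !addr0 add0r mulr1.
- apply: (integral_prod_eq0r (m1 := leb3) (m2 := leb1)
    (cont_bdd_supp_integrable4 cf)) => -[[a b] c] /=.
  rewrite -(f0 (a, b, c, 0)); apply: eq_integral => t _.
  by rewrite bE !mulr0 !addr0 add0r mulr1.
Qed.

End ContinuousBoundedSupport.

(** * Smooth functions and test functions *)

Section TestFunctions.
Context {R : realType}.
Implicit Types (Omega : set (R4 R)) (f g phi psi : R4 R -> R) (i : 'I_4).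

(** A class of functions closed under the partial derivatives by the Leibniz
    and quotient rules alone, whose members are therefore smooth. *)
Inductive smooth_closure : (R4 R -> R) -> Prop :=
| SmoothBase f : smooth_on setT f -> smooth_closure f
| SmoothCst (c : R) : smooth_closure (cst c)
| SmoothAdd f g : smooth_closure f -> smooth_closure g ->
    smooth_closure (f \+ g)
| SmoothMul f g : smooth_closure f -> smooth_closure g ->
    smooth_closure (f \* g)
| SmoothInv f : (forall x, f x != 0) -> smooth_closure f ->
    smooth_closure (fun x => (f x)^-1).

Lemma smooth_onT_pd i f : smooth_on setT f -> smooth_on setT (pd i f).
Proof. by move=> sf s x _; have := sf (rcons s i) x I; rewrite /pds foldr_rcons. Qed.

Lemma pdD i f g : (forall x, derivable f x (basis4 i)) ->
  (forall x, derivable g x (basis4 i)) -> pd i (f \+ g) = pd i f \+ pd i g.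
Proof. by move=> df dg; apply/funext => x; rewrite /pd deriveD. Qed.

Lemma pdM i f g : (forall x, derivable f x (basis4 i)) ->
  (forall x, derivable g x (basis4 i)) ->
  pd i (f \* g) = (f \* pd i g) \+ (g \* pd i f).
Proof.
by move=> df dg; apply/funext => x; rewrite /pd (@deriveM _ _ f g).
Qed.

Lemma pdV i f : (forall x, f x != 0) -> (forall x, derivable f x (basis4 i)) ->
  pd i (fun x => (f x)^-1) =
  cst (-1) \* ((fun x => (f x)^-1) \* (fun x => (f x)^-1)) \* pd i f.
Proof.
move=> f0 df; apply/funext => x; rewrite /pd deriveV//= mulN1r.
by rewrite -exprVn expr2.
Qed.

Lemma smooth_closureP f : smooth_closure f ->
  [/\ continuous f, forall i x, derivable f x (basis4 i) &
      forall i, smooth_closure (pd i f)].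
Proof.
elim=> {f} [f sf|c|f g sf [cf df pf] sg [cg dg pg]|f g sf [cf df pf] sg [cg dg pg]
  |f f0 sf [cf df pf]].
- split=> [x|i x|i]; first by have [] := sf [::] x I.
    by have [_] := sf [::] x I; apply.
  exact/SmoothBase/smooth_onT_pd.
- split=> [x|i x|i]; [exact: cvg_cst|exact: derivable_cst|].
  rewrite (_ : pd i _ = cst 0); first exact: SmoothCst.
  by apply/funext => x; rewrite /pd derive_cst.
- split=> [x|i x|i]; [exact: cvgD (cf x) (cg x)|exact: derivableD|].
  by rewrite pdD//; exact: SmoothAdd.
- split=> [x|i x|i]; [exact: cvgM (cf x) (cg x)|exact: derivableM|].
  by rewrite pdM//; apply: SmoothAdd; apply: SmoothMul.
- split=> [x|i x|i]; [exact: cvgV (cf x)|exact: derivableV|].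
  rewrite pdV//; apply: SmoothMul => //; apply: SmoothMul; first exact: SmoothCst.
  by apply: SmoothMul; exact: SmoothInv.
Qed.

Lemma smooth_closure_smooth f : smooth_closure f -> smooth_on setT f.
Proof.
move=> sf s x _.
have : smooth_closure (pds s f).
  by elim: s => [//|i s IH]; have [_ _] := smooth_closureP IH; exact.
by case/smooth_closureP => cs ds _; split=> [|i]; [exact: cs|exact: ds].
Qed.

Lemma smooth_onT_mul f g : smooth_on setT f -> smooth_on setT g ->
  smooth_on setT (f \* g).
Proof.
by move=> sf sg; apply: smooth_closure_smooth; apply: SmoothMul; exact: SmoothBase.
Qed.

Lemma smooth_onT_continuous f : smooth_on setT f -> continuous f.
Proof. by move=> sf x; have [] := sf [::] x I. Qed.

Lemma smooth_onT_derivable i f x : smooth_on setT f -> derivable f x (basis4 i).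
Proof. by move=> sf; have [_] := sf [::] x I; apply. Qed.

Lemma test_function_sub Omega phi f : test_function Omega phi ->
  smooth_on setT f ->
  [set x | f x != 0] `<=` closure [set x | phi x != 0] ->
  test_function Omega f.
Proof.
move=> [sphi cphi phiO] sf fphi.
have sub : closure [set x | f x != 0] `<=` closure [set x | phi x != 0].
  rewrite [X in _ `<=` X](closure_id _).1; last exact: closed_closure.
  exact: closureS.
split=> //; last exact: subset_trans phiO.
by apply: (subclosed_compact _ cphi sub); exact: closed_closure.
Qed.

Lemma test_functionM Omega phi f : test_function Omega phi ->
  smooth_on setT f -> test_function Omega (phi \* f).
Proof.
move=> tphi sf; apply: (test_function_sub tphi).
  by have [sphi _ _] := tphi; exact: smooth_onT_mul.
move=> x /= fx; apply: subset_closure => /=.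
by apply: contra fx => /eqP ->; rewrite mul0r.
Qed.

Lemma test_function_pd Omega phi i : test_function Omega phi ->
  test_function Omega (pd i phi).
Proof.
move=> tphi; apply: (test_function_sub tphi).
  by apply: smooth_onT_pd; case: tphi.
move=> x /= px; apply: contrapT => nx; move/eqP: px; apply.
rewrite /pd (@near_eq_derive _ _ _ _ (cst 0)); first by rewrite derive_cst.
have : nbhs x (~` closure [set y | phi y != 0]).
  by apply: open_nbhs_nbhs; split => //; apply: closed_openC; exact: closed_closure.
apply: filterS => y ny /=; apply/eqP; apply: contrapT => /negP py.
by apply: ny; exact: subset_closure.
Qed.

Lemma test_function_out Omega phi x : test_function Omega phi -> ~ Omega x ->
  phi x = 0.
Proof.
move=> [_ _ sub] nx; apply/eqP; apply: contrapT => /negP px.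
by apply/nx/sub; exact: subset_closure.
Qed.

Lemma test_function_cont_bdd_supp Omega phi : test_function Omega phi -> cont_bdd_supp phi.
Proof.
move=> tphi; have [sphi cK _] := tphi.
set K := closure _ in cK.
have phiK x : ~ K x -> phi x = 0.
  move=> nx; apply/eqP; apply: contrapT => /negP px.
  by apply: nx; exact: subset_closure.
have cphi := smooth_onT_continuous sphi.
split=> //.
  have : compact (phi @` K).
    by apply: continuous_compact => //; exact: continuous_subspaceT.
  move=> /compact_bounded [M [_ HM]].
  exists (`|M| + 1) => x; have [xK|xK] := pselect (K x); last first.
    by rewrite phiK// normr0 addr_ge0.
  apply: (HM (`|M| + 1)); last by exists x.
  by rewrite (le_lt_trans (ler_norm M))// ltrDl.
move/compact_bounded: cK => [M [_ HM]].
exists (`|M| + 1) => x; rewrite ltNge => /negP xM; apply: phiK => xK; apply: xM.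
by apply: HM xK; rewrite (le_lt_trans (ler_norm M))// ltrDl.
Qed.

Lemma cont_bdd_suppM f g : cont_bdd_supp f -> cont_bdd_supp g -> cont_bdd_supp (f \* g).
Proof.
move=> [cf [C fC] [M fM]] [cg [C' gC] _]; split.
- by move=> x; exact: cvgM (cf x) (cg x).
- by exists (C * C') => x; rewrite normrM ler_pM.
- by exists M => x /fM /= ->; rewrite mul0r.
Qed.

End TestFunctions.

(** * Integration by parts *)

Section IntegrationByParts.
Context {R : realType}.
Implicit Types (Omega : set (R4 R)) (f g phi psi : R4 R -> R) (i : 'I_4).

Lemma normr_basis4 i : `|basis4 i : R4 R| = 1.
Proof.
case: i => -[|[|[|[|//]]]] i4; rewrite /basis4 !prod_normE /= normr0 normr1.
- by rewrite !(max_l ler01).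
- by rewrite (max_r ler01) !(max_l ler01).
- by rewrite maxxx (max_r ler01) (max_l ler01).
- by rewrite !maxxx (max_r ler01).
Qed.

Lemma growth_along f x (v : R4 R) (t : R) :
  (fun h : R => h^-1 *: (f ((h *: (1 : R) + t) *: v + x) - f (t *: v + x))) =
  (fun h : R => h^-1 *: (f (h *: v + (t *: v + x)) - f (t *: v + x))).
Proof.
by apply/funext => h; rewrite [h *: (1 : R)]mulr1 scalerDl addrA.
Qed.

Lemma derivable_along f x (v : R4 R) (t : R) :
  derivable f (t *: v + x) v -> derivable (fun s : R => f (s *: v + x)) t 1.
Proof. by rewrite /derivable /comp /= growth_along. Qed.

Lemma derive_along f x (v : R4 R) (t : R) :
  (fun s : R => f (s *: v + x))^`()%classic t = 'D_v f (t *: v + x).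
Proof. by rewrite derive1E /derive /= growth_along. Qed.

(** The function vanishes at both ends of a long enough segment of the line, so
    that the fundamental theorem of calculus gives 0. *)
Lemma integral_pd_line i f x : cont_bdd_supp f -> continuous (pd i f) ->
  (forall y, derivable f y (basis4 i)) ->
  (\int[leb1]_t (pd i f (x + t *: basis4 i))%:E = 0)%E.
Proof.
move=> [cf _ [M fM]] cdf df; set b := basis4 i.
(* As the direction is a unit vector, every |t| >= N puts the point outside the
   support. *)
set N : R := `|M| + `|x| + 1.
have N0 : 0 < N by rewrite ltr_wpDl// addr_ge0.
have out t : N <= `|t| -> M < `|t *: b + x|.
  move=> Nt; have := lerB_normD (t *: b) x.
  rewrite normrZ normr_basis4 mulr1; apply: lt_le_trans.
  by rewrite (le_lt_trans (ler_norm M))// ltrBrDr (lt_le_trans _ Nt)// ltrDl.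
have out0 t : N < `|t| -> pd i f (t *: b + x) = 0.
  move=> Nt; rewrite /pd (@near_eq_derive _ _ _ _ (cst 0)) ?derive_cst//.
  have : M < `|t *: b + x| by apply: out; exact: ltW.
  move=> Mt; have := @norm_continuous _ _ (t *: b + x).
  by move/cvgr_gt => /(_ M Mt); apply: filterS => y; exact: fM.
have lineE t : x + t *: b = t *: b + x by rewrite addrC.
have cline : continuous (fun t : R => t *: b + x).
  move=> t; apply: cvgD; last exact: cvg_cst.
  by apply: cvgZr_tmp; exact: cvg_id.
have cdline : continuous (fun t : R => pd i f (t *: b + x)).
  by move=> t; apply: (continuous_comp (cline t)); exact: cdf.
have cfline : continuous (fun t : R => f (t *: b + x)).
  by move=> t; apply: (continuous_comp (cline t)); exact: cf.
pose I : set R := `[- N, N]%classic.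
rewrite (_ : (\int[leb1]_t _)%E =
   \int[lebesgue_measure]_(t in I) (pd i f (t *: b + x))%:E)%E; last first.
  rewrite [RHS]integral_mkcond; apply: eq_integral => t _; rewrite lineE patchE.
  case: ifPn => //; rewrite notin_setE /I /= in_itv /= -ler_norml => /negP.
  by rewrite -ltNge => /out0 ->.
rewrite (@continuous_FTC2 _ _ (fun t => f (t *: b + x))).
- by rewrite !fM ?subee// out// ?normrN gtr0_norm.
- by rewrite gtrN.
- exact: continuous_subspaceT.
- split.
  + by move=> t _; apply: derivable_along.
  + exact/cvg_at_right_filter/cfline.
  + exact/cvg_at_left_filter/cfline.
- by move=> t _; rewrite derive_along.
Qed.

Lemma integral_pd_eq0 Omega i phi : test_function Omega phi ->
  (\int[leb4]_x (pd i phi x)%:E = 0)%E.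
Proof.
move=> tphi; have [sphi _ _] := tphi.
have tp := test_function_pd i tphi.
apply: (integral4_eq0 (i := i)); first exact: test_function_cont_bdd_supp tp.
move=> x; apply: integral_pd_line; first exact: test_function_cont_bdd_supp tphi.
  by apply: smooth_onT_continuous; exact: smooth_onT_pd.
by move=> y; exact: smooth_onT_derivable.
Qed.

Lemma integral_out Omega f : measurable (Omega : set (mR4 R)) ->
  (forall x, ~ Omega x -> f x = 0) ->
  (\int[leb4]_(x in Omega) (f x)%:E = \int[leb4]_x (f x)%:E)%E.
Proof.
move=> mO f0; rewrite integral_mkcond; apply: eq_integral => x _.
by rewrite patchE; case: ifPn => //; rewrite notin_setE => /f0 ->.
Qed.

(** The integral of the derivative of a product of two test functions is 0. *)
Lemma weak_pd_test Omega i phi : open Omega -> test_function Omega phi ->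
  weak_pd Omega i phi (pd i phi).
Proof.
move=> oO tphi psi tpsi.
have mO := open_measurable4 oO.
have [sphi _ _] := tphi; have [spsi _ _] := tpsi.
have c1 : cont_bdd_supp (phi \* pd i psi).
  by apply: cont_bdd_suppM; apply: test_function_cont_bdd_supp; [exact: tphi|exact: test_function_pd tpsi].
have c2 : cont_bdd_supp (psi \* pd i phi).
  by apply: cont_bdd_suppM; apply: test_function_cont_bdd_supp; [exact: tpsi|exact: test_function_pd tphi].
have i1 := cont_bdd_supp_integrable4 c1; have i2 := cont_bdd_supp_integrable4 c2.
have := integral_pd_eq0 i (test_functionM tphi spsi).
rewrite pdM; [|by move=> x; exact: smooth_onT_derivable|
  by move=> x; exact: smooth_onT_derivable].
under eq_integral do rewrite EFinD.
rewrite integralD//= => E0.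
rewrite (integral_out mO); last first.
  by move=> x nx; rewrite (test_function_out tphi nx) mul0r.
rewrite (integral_out mO (f := fun x => pd i phi x * psi x)); last first.
  by move=> x nx; rewrite (test_function_out tpsi nx) mulr0.
under [in RHS]eq_integral do rewrite mulrC.
move: (integrable_fin_num measurableT i1) (integrable_fin_num measurableT i2) E0.
rewrite /=; case: (integral _ _ _) => // r _; case: (integral _ _ _) => // s _.
by rewrite -EFinD => -[/eqP]; rewrite addr_eq0 => /eqP ->.
Qed.

End IntegrationByParts.

(** * Test functions in H^1_0 *)

Section H10Approximation.
Context {R : realType}.
Implicit Types (Omega : set (R4 R)) (f phi u : R4 R -> R) (i : 'I_4)
  (g : 'I_4 -> R4 R -> R).

Lemma test_function_L2 Omega phi : open Omega -> test_function Omega phi ->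
  L2 Omega phi.
Proof.
move=> oO tphi; have mO := open_measurable4 oO.
have cphi := test_function_cont_bdd_supp tphi; have [cont _ _] := cphi.
split; first by apply: measurable_funTS; exact: continuous_measurable4.
have := integrableS measurableT mO (@subsetT _ _) (cont_bdd_supp_integrable4 (cont_bdd_suppM cphi cphi)).
move=> /integrableP[_]; congr (_ < _)%E; apply: eq_integral => x _.
by rewrite /= normrM expr2.
Qed.

Lemma H10_test Omega phi : open Omega -> test_function Omega phi ->
  H10 Omega phi (fun i => pd i phi).
Proof.
move=> oO tphi; split.
  split; first exact: test_function_L2.
  move=> i; split; last exact: weak_pd_test.
  by apply: test_function_L2 => //; exact: test_function_pd.
exists (fun=> phi); split => //.
rewrite (_ : (fun _ => _) = cst 0%E); first exact: cvg_cst.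
apply/funext => n; rewrite /H1_dist2 integral0_eq; last first.
  by move=> x _; rewrite subrr normr0 expr0n.
rewrite add0e big1// => i _; apply: integral0_eq => x _.
by rewrite subrr normr0 expr0n.
Qed.

(** The rate is the one that makes the squared errors summable in
    [fast_L2_cvg]. *)
Lemma H10_fast Omega u g : H10 Omega u g -> exists phi : nat -> R4 R -> R,
  forall n, [/\ test_function Omega (phi n),
    (\int[leb4]_(x in Omega) (`|u x - phi n x| ^+ 2)%:E
       <= (1 / (2 ^ (n + 1))%:R)%:E)%E &
    forall i, (\int[leb4]_(x in Omega) (`|g i x - pd i (phi n) x| ^+ 2)%:E
       <= (1 / (2 ^ (n + 1))%:R)%:E)%E].
Proof.
move=> [_ [phi [tphi cphi]]].
have step n : exists k, (H1_dist2 Omega u g (phi k) (fun i => pd i (phi k))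
    < (1 / (2 ^ (n + 1))%:R)%:E)%E.
  have c0 : (0 < (1 / (2 ^ (n + 1))%:R)%:E :> \bar R)%E.
    by rewrite lte_fin divr_gt0// ltr0n expn_gt0.
  have : \forall k \near \oo, (H1_dist2 Omega u g (phi k) (fun i => pd i (phi k))
      < (1 / (2 ^ (n + 1))%:R)%:E)%E by exact: cphi (open_ereal_lt' c0).
  by move/filter_ex.
have [k Hk] := choice step.
exists (fun n => phi (k n)) => n; have := ltW (Hk n); rewrite /H1_dist2 => dle.
have I0 (f : R4 R -> R) : (0 <= \int[leb4]_(x in Omega) (`|f x| ^+ 2)%:E)%E.
  by apply: integral_ge0 => x _; rewrite lee_fin sqr_ge0.
split=> [//||i].
  by apply: le_trans dle; rewrite leeDl// sume_ge0// => i _; exact: I0.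
apply: le_trans dle; rewrite (bigD1 i)//= addeCA leeDl//.
by apply: adde_ge0; [exact: I0|apply: sume_ge0 => j _; exact: I0].
Qed.

(** Besides approximating, the sequence has all its errors dominated at once,
    as dominated convergence requires. *)
Lemma H10_approx Omega u g : open Omega -> H10 Omega u g ->
  exists (phi : nat -> R4 R -> R) (S : 'I_4 -> R4 R -> R),
  [/\ forall n, test_function Omega (phi n),
      {ae leb4, forall x, Omega x -> phi ^~ x @ \oo --> u x},
      forall i, leb4.-integrable Omega (EFin \o S i) /\
                (forall x, Omega x -> 0 <= S i x),
      forall i, {ae leb4, forall x, Omega x -> forall n,
                 (g i x - pd i (phi n) x) ^+ 2 <= S i x} &
      forall i, {ae leb4, forall x, Omega x ->
                 (fun n => pd i (phi n) x) @ \oo --> g i x}].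
Proof.
move=> oO Hu; have mO := open_measurable4 oO.
have [phi Hphi] := H10_fast Hu.
have [[[mu _] Hg] _] := Hu.
have tphi n : test_function Omega (phi n) by have [] := Hphi n.
have mt f : test_function Omega f -> measurable_fun (Omega : set (mR4 R)) f.
  by move=> tf; have [] := test_function_L2 oO tf.
have [_ [_ _ _ cu]] : exists S : R4 R -> R, _ :=
  fast_L2_cvg mO (fun n => mt _ (tphi n)) mu
    (fun n => let: And3 _ H _ := Hphi n in H).
have /choice [S HS] : forall i, exists S : R4 R -> R, _ := fun i =>
  fast_L2_cvg mO (fun n => mt _ (test_function_pd i (tphi n))) (Hg i).1.1
    (fun n => let: And3 _ _ H := Hphi n in H i).
exists phi, S; split=> // i.
- by have [iS S0 _ _] := HS i.
- by have [_ _ dS _] := HS i.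
- by have [_ _ _ cS] := HS i.
Qed.

End H10Approximation.

(** * The regularised Picone inequality *)

Section RegularizedInverse.
Context {R : realType}.
Implicit Types (e t y a p : R).

(** A substitute for 1 / t. The shift by e makes t + e at least e for t >= 0, and
    the term e ^+ 3 = e * e ^+ 2 is small enough to cost only the factor 1 - e
    in [reg_picone], yet keeps the denominator positive on the whole line. *)
Definition reg_inv e t : R := (t + e) / ((t + e) ^+ 2 + e ^+ 3).

(** The derivative of [reg_inv e]. *)
Definition reg_inv' e t : R :=
  (e ^+ 3 - (t + e) ^+ 2) / ((t + e) ^+ 2 + e ^+ 3) ^+ 2.

Lemma reg_den_gt0 e t : 0 < e -> 0 < (t + e) ^+ 2 + e ^+ 3.
Proof. by move=> e0; rewrite ltr_wpDl ?sqr_ge0// exprn_gt0. Qed.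

Lemma reg_inv_ge0 e t : 0 < e -> 0 <= t -> 0 <= reg_inv e t.
Proof.
move=> e0 t0; rewrite divr_ge0//; first by rewrite addr_ge0// ltW.
exact/ltW/reg_den_gt0.
Qed.

Lemma reg_inv_bound e t : 0 < e < 1 -> `|reg_inv e t| <= (e ^+ 3)^-1.
Proof.
move=> /andP[e0 e1]; have d0 := reg_den_gt0 t e0.
have a0 : 0 < e ^+ 3 by rewrite exprn_gt0.
have a1 : e ^+ 3 <= 1 by rewrite exprn_ile1// ltW.
rewrite /reg_inv normrM normfV [X in _ / X]gtr0_norm//.
rewrite ler_pdivrMr// mulrC ler_pdivlMr//.
have -> : (t + e) ^+ 2 = `|t + e| ^+ 2 by rewrite real_normK ?num_real.
move: (normr_ge0 (t + e)) a0 a1; set s := `|_|; set b := e ^+ 3 => s0 b0 b1.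
have : s <= 1 + s ^+ 2 by have := sqr_ge0 (s - 1); nra.
have := sqr_ge0 s; nra.
Qed.

Lemma reg_inv'_bound e t : 0 < e < 1 -> `|reg_inv' e t| <= (e ^+ 3)^-1.
Proof.
move=> /andP[e0 e1]; have d0 := reg_den_gt0 t e0.
have a0 : 0 < e ^+ 3 by rewrite exprn_gt0.
rewrite /reg_inv' normrM normfV [X in _ / X]gtr0_norm ?exprn_gt0//.
rewrite ler_pdivrMr ?exprn_gt0// mulrC ler_pdivlMr//.
move: (sqr_ge0 (t + e)) d0 a0.
set s := (t + e) ^+ 2; set b := e ^+ 3 => s0 d0 b0.
have n1 : `|b - s| <= s + b by rewrite ler_norml; apply/andP; split; lra.
rewrite expr2; apply: ler_pM => //; lra.
Qed.

(** One component of Picone's inequality, where y and p stand for the values of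
    the test function and of its derivative, and a for the derivative of a
    function with value t. The left-hand side is at most
    2 p X - (1 - e) X^2 with X = y a (reg_inv e t), because
    reg_inv' e t <= - (1 - e) (reg_inv e t)^2 for t >= 0. *)
Lemma reg_picone e t y a p : 0 < e < 1 -> 0 <= t ->
  a * (2 * y * p * reg_inv e t + y ^+ 2 * reg_inv' e t * a)
    <= (1 - e)^-1 * p ^+ 2.
Proof.
move=> /andP[e0 e1] t0; have d0 := reg_den_gt0 t e0.
have k0 : 0 < 1 - e by rewrite subr_gt0.
have G2 : reg_inv' e t <= - ((1 - e) * reg_inv e t ^+ 2).
  rewrite /reg_inv' /reg_inv expr_div_n mulrA -[leRHS]mulNr ler_pM2r; last first.
    by rewrite invr_gt0 exprn_gt0.
  (* With s = t + e this reads e ^+ 3 - s ^+ 2 <= - (1 - e) * s ^+ 2. *)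
  have : e ^+ 2 <= (t + e) ^+ 2 by rewrite lerXn2r ?nnegrE//; lra.
  by rewrite exprS; move: (sqr_ge0 (t + e)); set s := _ ^+ 2; nra.
rewrite mulrC -[leRHS]mulrC ler_pdivlMr//.
move: G2; set G := reg_inv e t; set G' := reg_inv' e t => G2.
have : y ^+ 2 * a ^+ 2 * G' <= - (y ^+ 2 * a ^+ 2 * ((1 - e) * G ^+ 2)).
  by rewrite -mulrN ler_wpM2l// mulr_ge0// sqr_ge0.
have := sqr_ge0 ((1 - e) * (y * G * a) - p).
nra.
Qed.

Lemma cvg_reg_den e (f : nat -> R) t : f @ \oo --> t ->
  (fun n => (f n + e) ^+ 2 + e ^+ 3) @ \oo --> (t + e) ^+ 2 + e ^+ 3.
Proof.
move=> ft; apply: cvgD; last exact: cvg_cst.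
have fe : (fun n => f n + e) @ \oo --> t + e by apply: cvgD => //; exact: cvg_cst.
exact: cvgM.
Qed.

Lemma cvg_reg_inv e (f : nat -> R) t : 0 < e -> f @ \oo --> t ->
  (fun n => reg_inv e (f n)) @ \oo --> reg_inv e t.
Proof.
move=> e0 ft; apply: cvgM.
  by apply: cvgD => //; exact: cvg_cst.
by apply: cvgV; [exact/lt0r_neq0/reg_den_gt0|exact: cvg_reg_den].
Qed.

Lemma cvg_reg_inv' e (f : nat -> R) t : 0 < e -> f @ \oo --> t ->
  (fun n => reg_inv' e (f n)) @ \oo --> reg_inv' e t.
Proof.
move=> e0 ft; have d0 := reg_den_gt0 t e0; apply: cvgM.
  apply: cvgB; first exact: cvg_cst.
  have fe : (fun n => f n + e) @ \oo --> t + e by apply: cvgD => //; exact: cvg_cst.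
  exact: cvgM.
apply: cvgV; first by rewrite expf_neq0// lt0r_neq0.
by apply: cvgM; exact: cvg_reg_den.
Qed.

Lemma cvg_mul_reg_inv (e : nat -> R) t : 0 < t -> e @ \oo --> (0 : R) ->
  (fun n => t * reg_inv (e n) t) @ \oo --> (1 : R).
Proof.
move=> t0 e0; have te : (fun n => t + e n) @ \oo --> t.
  by rewrite -[X in _ --> X]addr0; apply: cvgD => //; exact: cvg_cst.
have -> : (1 : R) = t * (t / (t ^+ 2 + 0 ^+ 3)).
  by rewrite expr0n/= addr0; field; rewrite lt0r_neq0.
apply: cvgM; first exact: cvg_cst.
apply: cvgM => //; apply: cvgV.
  by rewrite expr0n/= addr0 expf_neq0// lt0r_neq0.
by apply: cvgD; [exact: cvgM|do 2! apply: cvgM => //].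
Qed.

Lemma continuous_reg_inv e : 0 < e -> continuous (reg_inv e).
Proof.
move=> e0 t; apply: cvgM; first by apply: cvgD; [exact: cvg_id|exact: cvg_cst].
apply: cvgV; first exact/lt0r_neq0/reg_den_gt0.
apply: cvgD; last exact: cvg_cst.
by apply: cvgM; (apply: cvgD; [exact: cvg_id|exact: cvg_cst]).
Qed.

Lemma continuous_reg_inv' e : 0 < e -> continuous (reg_inv' e).
Proof.
move=> e0 t; have d0 := reg_den_gt0 t e0.
have cs : (fun s => (s + e) ^+ 2) @ t --> (t + e) ^+ 2.
  by apply: cvgM; (apply: cvgD; [exact: cvg_id|exact: cvg_cst]).
have cd : (fun s => (s + e) ^+ 2 + e ^+ 3) @ t --> (t + e) ^+ 2 + e ^+ 3.
  by apply: cvgD; [|exact: cvg_cst].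
apply: cvgM; first by apply: cvgB => //; exact: cvg_cst.
apply: cvgV; first by rewrite expf_neq0// lt0r_neq0.
exact: cvgM.
Qed.

End RegularizedInverse.

Section PiconeTestFunction.
Context {R : realType}.
Implicit Types (Omega : set (R4 R)) (phi psi : R4 R -> R) (i : 'I_4) (e : R).

Definition picone_test e phi psi : R4 R -> R :=
  fun x => psi x ^+ 2 * reg_inv e (phi x).

(** Everything is built from [phi] and [psi] by the operations of
    [smooth_closure], so that smoothness needs no chain rule. *)
Lemma picone_test_pd e phi psi : 0 < e ->
  smooth_on setT phi -> smooth_on setT psi ->
  smooth_on setT (picone_test e phi psi) /\
  forall i x, pd i (picone_test e phi psi) x =
    2 * psi x * pd i psi x * reg_inv e (phi x)
    + psi x ^+ 2 * reg_inv' e (phi x) * pd i phi x.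
Proof.
move=> e0 sphi spsi.
pose s := phi \+ cst e; pose q := (s \* s) \+ cst (e ^+ 3).
have cs : smooth_closure s by apply: SmoothAdd; [exact: SmoothBase|exact: SmoothCst].
have cq : smooth_closure q by apply: SmoothAdd; [exact: SmoothMul|exact: SmoothCst].
have q0 x : q x != 0 by exact/lt0r_neq0/reg_den_gt0.
have cr := SmoothInv q0 cq; set r := (fun x => (q x)^-1) in cr.
have cp : smooth_closure psi by exact: SmoothBase.
have wE : picone_test e phi psi = (psi \* psi) \* (s \* r).
  by apply/funext => x.
have cpp : smooth_closure (psi \* psi) by exact: SmoothMul.
have csr : smooth_closure (s \* r) by exact: SmoothMul.
split; first by rewrite wE; apply: smooth_closure_smooth; exact: SmoothMul.
move=> i x; rewrite wE.
have D (f : R4 R -> R) : smooth_closure f -> forall y, derivable f y (basis4 i).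
  by move=> /smooth_closureP[_ df _] y.
have dc c : forall y : R4 R, derivable (cst c : R4 R -> R) y (basis4 i).
  by move=> y; exact: derivable_cst.
have pc c : pd i (cst c : R4 R -> R) = cst 0.
  by apply/funext => y; rewrite /pd derive_cst.
have ps : pd i s = pd i phi \+ cst 0.
  by rewrite pdD ?pc//; exact/D/SmoothBase.
have pq : pd i q = (s \* pd i s) \+ (s \* pd i s) \+ cst 0.
  by rewrite pdD ?pc ?pdM//; apply: D => //; exact: SmoothMul.
rewrite (pdM (D _ cpp) (D _ csr)) (pdM (D _ cp) (D _ cp)) (pdM (D _ cs) (D _ cr)).
rewrite (pdV q0 (D _ cq)) pq ps /r /= /reg_inv /reg_inv' -/(s x).
have := q0 x; rewrite /q /s /= => q0x.
field.
exact: q0x.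
Qed.

End PiconeTestFunction.

(** * Positive supersolutions *)

#[local] Instance ae_leb4_filter {R : realType} :
  Filter (nbhs (almost_everywhere (@leb4 R))).
Proof. exact: ae_filter_ringOfSetsType. Qed.

Section PiconeLimit.
Context {R : realType}.
Variables (Omega : set (R4 R)) (u f V : R4 R -> R).
Hypothesis oO : open Omega.
Hypothesis Ofin : (leb4 Omega < +oo)%E.
Hypothesis weak : weak_dirichlet_solution Omega u f.
Hypothesis upos : positive_in Omega u.
Hypothesis mf : measurable_fun (Omega : set (mR4 R)) f.
Hypothesis mV : measurable_fun (Omega : set (mR4 R)) V.
Hypothesis V0 : forall x, Omega x -> 0 <= V x.
Hypothesis fV : {ae leb4, forall x, Omega x -> V x * u x <= f x}.

Let mO : measurable (Omega : set (mR4 R)) := open_measurable4 oO.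

Lemma test_function_measurable phi : test_function Omega phi ->
  measurable_fun (Omega : set (mR4 R)) phi.
Proof. by move=> tp; have [] := test_function_L2 oO tp. Qed.

Lemma integrable_grad_test (g : 'I_4 -> R4 R -> R) phi :
  (forall i, L2 Omega (g i)) -> test_function Omega phi ->
  leb4.-integrable Omega (fun x => (\sum_(i < 4) g i x * pd i phi x)%:E).
Proof.
move=> Hg tphi.
apply: (integrable_sum_EFin mO (f := fun i x => g i x * pd i phi x)) => i.
have [mg g2] := Hg i; have tp := test_function_pd i tphi.
have [_ [C HC] _] := test_function_cont_bdd_supp tp.
apply: (integrableM_bounded mO (integrable_L2 mO Ofin mg g2)) => [|x _].
  exact: test_function_measurable.
exact: HC.
Qed.

(** The square of a test function is an admissible test function, and the
    nonlinearity times this square is nonnegative almost everywhere, so that the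
    finiteness of the left-hand side of the weak equation is enough. *)
Lemma rhs_integrable psi : test_function Omega psi ->
  leb4.-integrable Omega (fun x => (f x * psi x ^+ 2)%:E).
Proof.
move=> tpsi; have [spsi _ _] := tpsi.
have tpp : test_function Omega (psi \* psi) by exact: test_functionM.
have [g [Hu Eu]] := weak; have [[_ Hg] _] := Hu.
have := Eu _ _ (H10_test oO tpp) => E.
have fin := integrable_fin_num mO
  (integrable_grad_test (fun i => (Hg i).1) tpp).
have mh : measurable_fun (Omega : set (mR4 R)) (fun x => f x * psi x ^+ 2).
  by apply: measurable_funM => //; apply: measurable_funX;
    exact: test_function_measurable.
apply/integrableP; split; first exact/measurable_EFinP.
rewrite [ltLHS](_ : _ = \int[leb4]_(x in Omega) (f x * (psi \* psi) x)%:E)%E.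
  by rewrite -E ltey_eq fin.
apply: ae_eq_integral => //.
- by apply: measurableT_comp => //; exact/measurable_EFinP.
- exact/measurable_EFinP.
move: (upos) (fV); apply: filterS2 => x ux fx Ox.
rewrite gee0_abs ?expr2// lee_fin mulr_ge0 ?sqr_ge0//.
by apply: le_trans (fx Ox); rewrite mulr_ge0 ?V0// ltW// ux.
Qed.

Section Limit.
Variables (e : R) (psi : R4 R -> R).
Hypothesis e01 : 0 < e < 1.
Hypothesis tpsi : test_function Omega psi.

Let e0 : 0 < e. Proof. by case/andP: e01. Qed.
Let b := (e ^+ 3)^-1.

Lemma picone_test_function phi : test_function Omega phi ->
  test_function Omega (picone_test e phi psi).
Proof.
move=> [sphi _ _]; have [spsi _ _] := tpsi.
apply: (test_function_sub tpsi); first by have [] := picone_test_pd e0 sphi spsi.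
move=> x /= wx; apply: subset_closure => /=; apply: contra wx => /eqP px.
by rewrite /picone_test px expr0n mul0r.
Qed.

Lemma measurable_reg_inv h : measurable_fun (Omega : set (mR4 R)) h ->
  measurable_fun (Omega : set (mR4 R)) (fun x => reg_inv e (h x)).
Proof.
by move=> mh; apply: measurableT_comp => //; apply: continuous_measurable_fun;
  exact: continuous_reg_inv.
Qed.

Lemma measurable_reg_inv' h : measurable_fun (Omega : set (mR4 R)) h ->
  measurable_fun (Omega : set (mR4 R)) (fun x => reg_inv' e (h x)).
Proof.
by move=> mh; apply: measurableT_comp => //; apply: continuous_measurable_fun;
  exact: continuous_reg_inv'.
Qed.

(** The weak equation tested with [picone_test e phi psi]. As [reg_inv e] is
    bounded, the nonlinear term is integrable by [rhs_integrable]. *)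
Lemma defect_eq0 g phi : (forall i, L2 Omega (g i)) ->
  (forall phi h, H10 Omega phi h ->
      (\int[leb4]_(x in Omega) (\sum_(i < 4) g i x * h i x)%R%:E =
       \int[leb4]_(x in Omega) (f x * phi x)%:E)%E) ->
  test_function Omega phi ->
  let w := picone_test e phi psi in
  leb4.-integrable Omega (fun x => (\sum_(i < 4) g i x * pd i w x - f x * w x)%:E) /\
  (\int[leb4]_(x in Omega) (\sum_(i < 4) g i x * pd i w x - f x * w x)%:E = 0)%E.
Proof.
move=> Hg Eu tphi w; have tw : test_function Omega w by exact: picone_test_function.
have i1 := integrable_grad_test Hg tw.
have i2 : leb4.-integrable Omega (fun x => (f x * w x)%:E).
  under eq_fun do rewrite mulrA.
  apply: (integrableM_bounded mO (rhs_integrable tpsi) (C := b)).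
    by apply: measurable_reg_inv; exact: test_function_measurable.
  by move=> x _; exact: reg_inv_bound.
split; first exact: integrableB_EFin.
under eq_integral do rewrite EFinB.
rewrite integralB// (Eu _ _ (H10_test oO tw)) subee//.
exact: integrable_fin_num.
Qed.

(** The identity of [defect_eq0] survives the limit in which [phi] tends to
    [u]: values and gradients converge almost everywhere, and the only
    unbounded factor that depends on the approximation, the gradient of [phi],
    differs from that of [u] by an error dominated in L^2. *)
Lemma defect_limit : exists g, (forall i, L2 Omega (g i)) /\
  let h := fun x =>
    \sum_(i < 4) g i x * (2 * psi x * pd i psi x * reg_inv e (u x)
                          + psi x ^+ 2 * reg_inv' e (u x) * g i x)
    - f x * (psi x ^+ 2 * reg_inv e (u x)) in
  leb4.-integrable Omega (EFin \o h) /\ (\int[leb4]_(x in Omega) (h x)%:E = 0)%E.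
Proof.
have [g [Hu Eu]] := weak; have [[[mu _] Hg] _] := Hu.
have {}Hg i : L2 Omega (g i) by exact: (Hg i).1.
exists g; split=> //; move=> h.
have [spsi _ _] := tpsi.
have [phi [S [tphi cu iS dS cS]]] := H10_approx oO Hu.
pose hn n x := \sum_(i < 4) g i x * pd i (picone_test e (phi n) psi) x
  - f x * picone_test e (phi n) psi x.
have hnP n : leb4.-integrable Omega (EFin \o hn n) /\
    (\int[leb4]_(x in Omega) (hn n x)%:E = 0)%E.
  exact: defect_eq0.
have cpsi := test_function_cont_bdd_supp tpsi.
have [_ [C HC] _] := cpsi.
have C0 : 0 <= C by exact: le_trans (HC 0).
have /choice [K HK] i : exists K, forall x, `|pd i psi x| <= K.
  by have [_ [K HK] _] := test_function_cont_bdd_supp (test_function_pd i tpsi); exists K.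
have b0 : 0 < b by rewrite invr_gt0 exprn_gt0.
pose M x := \sum_(i < 4) (2 * C * K i * b * `|g i x|
     + C ^+ 2 * b * (2 * g i x ^+ 2 + S i x)) + b * `|f x * psi x ^+ 2|.
have iM : leb4.-integrable Omega (EFin \o M).
  apply: (integrableD_EFin mO); last first.
    by apply: integrableZ_EFin => //; exact: integrable_norm_EFin (rhs_integrable _).
  apply: (integrable_sum_EFin mO (f := fun i x => 2 * C * K i * b * `|g i x|
     + C ^+ 2 * b * (2 * g i x ^+ 2 + S i x))) => i.
  have [mg g2] := Hg i.
  apply: (integrableD_EFin mO); apply: integrableZ_EFin => //.
    exact/integrable_norm_EFin/integrable_L2.
  apply: (integrableD_EFin mO); last by have [] := iS i.
  by apply: integrableZ_EFin => //; exact: integrable_sqr.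
have mh : measurable_fun (Omega : set (mR4 R)) h.
  have mpsi := test_function_measurable tpsi.
  apply: measurable_funB.
    apply: measurable_sum => i; have [mg _] := Hg i.
    have mpi := test_function_measurable (test_function_pd i tpsi).
    apply: measurable_funM => //; apply: measurable_funD.
      apply: measurable_funM; last exact: measurable_reg_inv.
      by apply: measurable_funM => //; exact: measurable_funM.
    apply: measurable_funM => //; apply: measurable_funM.
      exact: measurable_funX.
    exact: measurable_reg_inv'.
  apply: measurable_funM => //; apply: measurable_funM.
    exact: measurable_funX.
  exact: measurable_reg_inv.
have pdE n i x : pd i (picone_test e (phi n) psi) x =
    2 * psi x * pd i psi x * reg_inv e (phi n x)
    + psi x ^+ 2 * reg_inv' e (phi n x) * pd i (phi n) x.
  by have [sphi _ _] := tphi n; have [_] := picone_test_pd e0 sphi spsi.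
have cS' : {ae leb4, forall x, forall i, Omega x ->
    (fun n => pd i (phi n) x) @ \oo --> g i x} by exact: filter_forall.
have dS' : {ae leb4, forall x, forall i, Omega x -> forall n,
    (g i x - pd i (phi n) x) ^+ 2 <= S i x} by exact: filter_forall.
have cvh : {ae leb4, forall x, Omega x -> (fun n => (hn n x)%:E) @ \oo --> (h x)%:E}.
  move: cu cS'; apply: filterS2 => x cux cSx Ox.
  apply: cvg_EFin; first exact: nearW.
  have cG := cvg_reg_inv e0 (cux Ox); have cG' := cvg_reg_inv' e0 (cux Ox).
  rewrite /hn /h /comp /=; apply: cvgB.
    apply: (cvg_big (@add_continuous R)) => i _; apply: cvgM; first exact: cvg_cst.
    under eq_fun do rewrite pdE.
    apply: cvgD; first by apply: cvgM => //; exact: cvg_cst.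
    by apply: cvgM; [apply: cvgM => //; exact: cvg_cst|exact: cSx].
  by apply: cvgM; [exact: cvg_cst|apply: cvgM => //; exact: cvg_cst].
have hM : {ae leb4, forall x, forall n, Omega x -> (`|(hn n x)%:E| <= (M x)%:E)%E}.
  move: dS'; apply: filterS => x dSx n Ox; rewrite lee_fin.
  rewrite /hn /M (le_trans (ler_normB _ _))// lerD//.
    rewrite (le_trans (ler_norm_sum _ _ _))// ler_sum// => i _.
    rewrite pdE normrM.
    have G1 := reg_inv_bound (phi n x) e01; have G2 := reg_inv'_bound (phi n x) e01.
    have A1 : `|2 * psi x * pd i psi x * reg_inv e (phi n x)| <= 2 * C * K i * b.
      move: G1; move: (reg_inv _ _) => G G1.
      rewrite !normrM ger0_norm//.
      apply: ler_pM => //.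
      by apply: ler_pM => //; rewrite ?mulr_ge0// ler_pM2l.
    have A2 : `|psi x ^+ 2 * reg_inv' e (phi n x)| <= C ^+ 2 * b.
      move: G2; move: (reg_inv' _ _) => G G2.
      by rewrite normrM normrX ler_pM ?exprn_ge0// lerXn2r ?nnegrE.
    have A3 : `|g i x| * `|pd i (phi n) x| <= 2 * g i x ^+ 2 + S i x.
      exact: normM_le_sqr_dist (dSx i Ox n).
    apply: (@le_trans _ _ (`|g i x| * (2 * C * K i * b)
        + (C ^+ 2 * b) * (`|g i x| * `|pd i (phi n) x|))).
      rewrite (mulrCA (C ^+ 2 * b)) -mulrDr ler_wpM2l// (le_trans (ler_normD _ _))//.
      by rewrite lerD// normrM ler_wpM2r.
    apply: lerD; first by rewrite mulrC.
    apply: ler_wpM2l A3; apply: mulr_ge0; [exact: exprn_ge0|exact: ltW].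
  rewrite /picone_test mulrA normrM mulrC; apply: ler_wpM2r => //.
  exact: reg_inv_bound.
have mhE : measurable_fun (Omega : set (mR4 R)) (EFin \o h) by exact/measurable_EFinP.
have mhn n : measurable_fun (Omega : set (mR4 R)) (EFin \o hn n).
  exact: measurable_int (hnP n).1.
have [ih _ ch] := dominated_convergence mO mhn mhE cvh iM hM.
split=> //; apply/esym; apply: (cvg_unique _ _ ch) => //.
rewrite (_ : (fun _ => _) = cst 0%E); first exact: cvg_cst.
by apply/funext => n; exact: (hnP n).2.
Qed.

(** Subtracting the identity of [defect_limit], which has integral zero, turns
    the inequality into the pointwise one of [reg_picone]. The absolute values
    make the left-hand side nonnegative everywhere, and not just almost
    everywhere. *)
Lemma picone_weak :
  (\int[leb4]_(x in Omega) (V x * (`|u x| * reg_inv e `|u x|) * psi x ^+ 2)%:E <=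
   \int[leb4]_(x in Omega) ((1 - e)^-1 * \sum_(i < 4) pd i psi x ^+ 2)%:E)%E.
Proof.
have [g [Hg]] := defect_limit; set h := (fun x => _ - _) => -[ih h0].
have mpsi := test_function_measurable tpsi.
have [_ [[[[mu _] _] _] _]] := weak.
have ip : leb4.-integrable Omega
    (fun x => ((1 - e)^-1 * \sum_(i < 4) pd i psi x ^+ 2)%:E).
  apply: (integrableZ_EFin mO).
  apply: (integrable_sum_EFin mO (f := fun i x => pd i psi x ^+ 2)) => i.
  have [mp p2] := test_function_L2 oO (test_function_pd i tpsi).
  exact: integrable_sqr.
rewrite -[leRHS]sube0 -h0 -integralB//.
apply: (ae_le_integral mO (B := fun x =>
  (1 - e)^-1 * (\sum_(i < 4) pd i psi x ^+ 2) - h x)) => [|x Ox||].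
- have mau : measurable_fun (Omega : set (mR4 R)) (fun x => `|u x|).
    exact: measurableT_comp.
  apply: measurable_funM; last exact: measurable_funX.
  by apply: measurable_funM => //; apply: measurable_funM => //;
    exact: measurable_reg_inv.
- by rewrite mulr_ge0 ?sqr_ge0// mulr_ge0 ?V0// mulr_ge0// reg_inv_ge0.
- exact: integrableB_EFin.
move: (upos) (fV); apply: filterS2 => x ux fx Ox.
have {}ux := ux Ox; have {}fx := fx Ox.
rewrite gtr0_norm// /h.
have G0 := reg_inv_ge0 e0 (ltW ux).
have P2 : 0 <= psi x ^+ 2 by exact: sqr_ge0.
have S1 : \sum_(i < 4) g i x * (2 * psi x * pd i psi x * reg_inv e (u x)
       + psi x ^+ 2 * reg_inv' e (u x) * g i x) <=
    (1 - e)^-1 * \sum_(i < 4) pd i psi x ^+ 2.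
  rewrite mulr_sumr ler_sum// => i _.
  by apply: reg_picone => //; exact: ltW.
have : V x * u x * (psi x ^+ 2 * reg_inv e (u x)) <=
       f x * (psi x ^+ 2 * reg_inv e (u x)) by rewrite ler_wpM2r// mulr_ge0.
rewrite (_ : V x * _ * _ = V x * u x * (psi x ^+ 2 * reg_inv e (u x))); last first.
  by ring.
move=> fle; rewrite opprB addrCA (le_trans fle)// lerDl.
by rewrite subr_ge0.
Qed.

End Limit.

(** The inequality of [picone_weak] for test functions that approximate [w] and
    for a regularisation parameter that tends to 0 at the same time. Fatou's
    lemma is enough on the left, where V may be unbounded. *)
Lemma potential_energy_le w k : H10 Omega w k ->
  (\int[leb4]_(x in Omega) (V x * w x ^+ 2)%:E <=
   \int[leb4]_(x in Omega) (\sum_(i < 4) k i x ^+ 2)%:E)%E.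
Proof.
move=> Hw; have [[[mw _] Hk] _] := Hw.
have [_ [[[[mu _] _] _] _]] := weak.
have [psi [S [tpsi cw iS dS cS]]] := H10_approx oO Hw.
(* Starting at 1/2 bounds the factors (1 - e m)^-1 by 2. *)
pose e (m : nat) : R := m.+2%:R^-1.
have e01 m : 0 < e m < 1.
  by rewrite invr_gt0 ltr0n /= invf_lt1 ?ltr0n// ltr1n.
have e0 : e @ \oo --> (0 : R).
  by have := @cvg_harmonic R; rewrite -cvg_shiftS; exact.
have c1 : (fun m => (1 - e m)^-1) @ \oo --> (1 : R).
  rewrite -[X in _ --> X]invr1; apply: cvgV; first exact: oner_neq0.
  by rewrite -[X in _ --> X]subr0; apply: cvgB => //; exact: cvg_cst.
have c2 m : 0 <= (1 - e m)^-1 <= 2.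
  have h : e m <= 2^-1 by rewrite lef_pV2 ?posrE ?ltr0n// ler_nat.
  have d0 : 0 < 1 - e m by rewrite subr_gt0; case/andP: (e01 m).
  by rewrite invr_ge0 ltW//= -[leRHS]invrK lef_pV2 ?posrE ?invr_gt0 ?ltr0n//; lra.
have mS m i := test_function_measurable (test_function_pd i (tpsi m)).
have mau : measurable_fun (Omega : set (mR4 R)) (fun x => `|u x|).
  exact: measurableT_comp.
have cS' : {ae leb4, forall x, forall i, Omega x ->
    (fun n => pd i (psi n) x) @ \oo --> k i x} by exact: filter_forall.
have dS' : {ae leb4, forall x, forall i, Omega x -> forall n,
    (k i x - pd i (psi n) x) ^+ 2 <= S i x} by exact: filter_forall.
pose b m x := (1 - e m)^-1 * \sum_(i < 4) pd i (psi m) x ^+ 2.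
pose M x := 2 * \sum_(i < 4) (2 * k i x ^+ 2 + 2 * S i x).
have mb m : measurable_fun (Omega : set (mR4 R)) (EFin \o b m).
  apply/measurable_EFinP; apply: measurable_funM => //.
  by apply: measurable_sum => i; exact: measurable_funX.
have mk : measurable_fun (Omega : set (mR4 R)) (fun x => (\sum_(i < 4) k i x ^+ 2)%:E).
  apply/measurable_EFinP; apply: measurable_sum => i.
  by apply: measurable_funX; have [[]] := Hk i.
have iM : leb4.-integrable Omega (EFin \o M).
  apply: (integrableZ_EFin mO).
  apply: (integrable_sum_EFin mO (f := fun i x => 2 * k i x ^+ 2 + 2 * S i x)) => i.
  have [[mki k2] _] := Hk i.
  apply: (integrableD_EFin mO); apply: integrableZ_EFin => //.
    exact: integrable_sqr.
  by have [] := iS i.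
have cvb : {ae leb4, forall x, Omega x ->
    (fun m => (b m x)%:E) @ \oo --> (\sum_(i < 4) k i x ^+ 2)%:E}.
  move: cS'; apply: filterS => x cSx Ox.
  apply: cvg_EFin; first exact: nearW.
  rewrite /b /comp /= -[X in _ --> X]mul1r; apply: cvgM => //.
  by apply: (cvg_big (@add_continuous R)) => i _; apply: cvgM; exact: cSx.
have bM : {ae leb4, forall x, forall m, Omega x -> (`|(b m x)%:E| <= (M x)%:E)%E}.
  move: dS'; apply: filterS => x dSx m Ox; rewrite lee_fin /b /M normrM.
  have /andP[c20 c22] := c2 m.
  rewrite ger0_norm// ger0_norm ?sumr_ge0// => [|i _]; last exact: sqr_ge0.
  apply: ler_pM => //; first by rewrite sumr_ge0// => i _; exact: sqr_ge0.
  by apply: ler_sum => i _; exact: sqr_le_sqr_dist (dSx i Ox m).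
have [_ _ lb] := dominated_convergence mO mb mk cvb iM bM.
apply: (fatou_ae mO _ _ _ _ _ (fun m => picone_weak (e01 m) (tpsi m)) lb).
- move=> m; have mpsi := test_function_measurable (tpsi m).
  have e0m : 0 < e m by case/andP: (e01 m).
  apply: measurable_funM; last exact: measurable_funX.
  by apply: measurable_funM => //; apply: measurable_funM => //;
    exact: measurable_reg_inv.
- by apply: measurable_funM => //; exact: measurable_funX.
- move=> m x Ox; have e0m : 0 < e m by case/andP: (e01 m).
  by rewrite mulr_ge0 ?sqr_ge0// mulr_ge0 ?V0// mulr_ge0// reg_inv_ge0.
- by move=> x Ox; rewrite mulr_ge0 ?V0// sqr_ge0.
move: (upos) cw; apply: filterS2 => x ux cwx Ox; have {}ux := ux Ox.
rewrite gtr0_norm//; apply: cvgM; last by apply: cvgM; exact: cwx.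
rewrite -[X in _ --> X]mulr1; apply: cvgM; first exact: cvg_cst.
exact: cvg_mul_reg_inv.
Qed.

End PiconeLimit.

(** * Nonexistence *)

(** With t = mu s / |theta| the inequality is |theta| (t - 1 - ln t) >= 0. *)
Lemma Sigma2_le {R : realType} (lO lambda mu theta s : R) :
  Sigma2 lO (lambda, mu, theta) -> 0 < s ->
  lO <= lambda + mu * s + theta * ln s.
Proof.
move=> [t0 mu0 H] s0.
have a0 : 0 < `|theta| by rewrite normr_gt0 lt_eqF.
have := expR_ge1Dx (ln (mu * s / `|theta|)).
rewrite lnK ?posrE ?divr_gt0 ?mulr_gt0//.
rewrite ln_div ?posrE ?mulr_gt0// lnM ?posrE// ler_pdivlMr//.
move: H; rewrite (ltr0_norm t0); set L := ln (- theta); set a := ln mu; set c := ln s.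
by move: (mu * s) => p; nra.
Qed.

Section NoPositiveSolution.
Context {R : realType}.

Lemma bounded_measure_lty (Omega : set (R4 R)) : open Omega ->
  bounded_set Omega -> (leb4 Omega < +oo)%E.
Proof.
move=> oO [M [_ HM]]; have mO := open_measurable4 oO.
have [mB] := ball4_measure_lty (`|M| + 1); apply: le_lt_trans; apply: le_measure.
- by rewrite inE.
- by rewrite inE.
- by move=> x Ox; apply: HM Ox; rewrite (le_lt_trans (ler_norm M))// ltrDl.
Qed.

Variables (Omega : set (R4 R)) (lO : R).
Hypothesis hOmega : bounded_smooth_domain Omega.
Hypothesis hlO : dirichlet_eigenvalue Omega lO.

Let oO : open Omega. Proof. by case: hOmega. Qed.
Let mO : measurable (Omega : set (mR4 R)) := open_measurable4 oO.
Let Ofin : (leb4 Omega < +oo)%E.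
Proof. by have [_ _ _ bO _] := hOmega; exact: bounded_measure_lty. Qed.

Lemma eigenfunction_energy : exists e k,
  [/\ H10 Omega e k, ~ {ae leb4, forall x, Omega x -> e x = 0} &
   (\int[leb4]_(x in Omega) (\sum_(i < 4) k i x ^+ 2)%:E =
    \int[leb4]_(x in Omega) (lO * e x ^+ 2)%:E)%E].
Proof.
have [e ne [k [He Ee]]] := hlO.
exists e, k; split=> //; have := Ee _ _ He.
under eq_integral do under eq_bigr do rewrite -expr2.
by under [in RHS]eq_integral do rewrite -mulrA -expr2.
Qed.

(** Makes the potential lO + beta v^2 nonnegative, as Fatou's lemma requires. *)
Lemma eigenvalue_ge0 : 0 <= lO.
Proof.
have [e [k [He ne E]]] := eigenfunction_energy; have [[[me e2] _] _] := He.
rewrite leNgt; apply/negP => l0; apply: ne.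
have : {ae leb4, forall x, Omega x -> - lO * e x ^+ 2 = 0}.
  apply: (ae_eq0_of_integral_le0 mO).
  - by apply: measurable_funM => //; exact: measurable_funX.
  - by move=> x _; rewrite mulr_ge0 ?sqr_ge0// oppr_ge0 ltW.
  have ie2 := integrable_sqr me e2.
  have K0 : (0 <= \int[leb4]_(x in Omega) (\sum_(i < 4) k i x ^+ 2)%:E)%E.
    by apply: integral_ge0 => x _; rewrite lee_fin sumr_ge0// => i _; exact: sqr_ge0.
  have EI c : (\int[leb4]_(x in Omega) (c * e x ^+ 2)%:E =
    c%:E * \int[leb4]_(x in Omega) (e x ^+ 2)%:E)%E by exact: (integralZl mO ie2 c).
  by move: K0; rewrite E !EI EFinN mulNe oppe_le0.
apply: filterS => x H Ox; have /eqP := H Ox.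
by rewrite mulf_eq0 oppr_eq0 lt_eqF//= sqrf_eq0 => /eqP.
Qed.

Lemma no_positive_solution (lambda mu theta beta : R) (u v : R4 R -> R) :
  0 < beta -> Sigma2 lO (lambda, mu, theta) ->
  weak_dirichlet_solution Omega u (fun x =>
    lambda * u x + mu * `|u x| ^+ 2 * u x + beta * `|v x| ^+ 2 * u x
    + theta * (u x * ln (u x ^+ 2))) ->
  measurable_fun (Omega : set (mR4 R)) v ->
  positive_in Omega u -> positive_in Omega v -> False.
Proof.
move=> b0 HS wu mv up vp.
have [_ [[[[mu' _] _] _] _]] := wu.
have [e [k [He ne E]]] := eigenfunction_energy; have [[[me e2] _] _] := He.
have l0 := eigenvalue_ge0.
pose V x := lO + beta * v x ^+ 2.
have mv2 : measurable_fun (Omega : set (mR4 R)) (fun x => beta * v x ^+ 2).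
  by apply: measurable_funM => //; exact: measurable_funX.
have me2 : measurable_fun (Omega : set (mR4 R)) (fun x => e x ^+ 2).
  exact: measurable_funX.
have bv0 x : 0 <= beta * v x ^+ 2 by rewrite mulr_ge0 ?sqr_ge0// ltW.
have mf : measurable_fun (Omega : set (mR4 R)) (fun x =>
    lambda * u x + mu * `|u x| ^+ 2 * u x + beta * `|v x| ^+ 2 * u x
    + theta * (u x * ln (u x ^+ 2))).
  apply: measurable_funD; [apply: measurable_funD; [apply: measurable_funD|]|].
  - exact: measurable_funM.
  - apply: measurable_funM => //; apply: measurable_funM => //.
    by apply: measurable_funX; exact: measurableT_comp.
  - apply: measurable_funM => //; apply: measurable_funM => //.
    by apply: measurable_funX; exact: measurableT_comp.
  - apply: measurable_funM => //; apply: measurable_funM => //.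
    by apply: measurableT_comp; [exact: measurable_ln|exact: measurable_funX].
have mV : measurable_fun (Omega : set (mR4 R)) V by exact: measurable_funD.
have V0 x : Omega x -> 0 <= V x by move=> _; rewrite addr_ge0.
have fV : {ae leb4, forall x, Omega x -> V x * u x <=
    lambda * u x + mu * `|u x| ^+ 2 * u x + beta * `|v x| ^+ 2 * u x
    + theta * (u x * ln (u x ^+ 2))}.
  apply: filterS up => x ux Ox; have {}ux := ux Ox.
  have := Sigma2_le HS (exprn_gt0 2 ux).
  rewrite /V !real_normK ?num_real// => H.
  rewrite [leRHS](_ : _ = (lambda + mu * u x ^+ 2 + theta * ln (u x ^+ 2)
     + beta * v x ^+ 2) * u x); last by ring.
  by rewrite ler_pM2r// lerD2r.
(* The eigenfunction is used here as an arbitrary element of H^1_0: its sign does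
   not matter. *)
have := potential_energy_le oO Ofin wu up mf mV V0 fV He.
rewrite E => H.
have : {ae leb4, forall x, Omega x -> beta * v x ^+ 2 * e x ^+ 2 = 0}.
  apply: (ae_eq0_of_integral_le0 mO) => [|x _|].
  - exact: measurable_funM.
  - by rewrite mulr_ge0// sqr_ge0.
  move: H; rewrite (_ : (\int[leb4]_(x in Omega) (V x * e x ^+ 2)%:E =
    \int[leb4]_(x in Omega) (lO * e x ^+ 2)%:E +
    \int[leb4]_(x in Omega) (beta * v x ^+ 2 * e x ^+ 2)%:E)%E); last first.
    rewrite -ge0_integralD//.
    - by apply: eq_integral => x _; rewrite -EFinD -mulrDl.
    - by move=> x _; rewrite lee_fin mulr_ge0// sqr_ge0.
    - by apply/measurable_EFinP; exact: measurable_funM.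
    - by move=> x _; rewrite lee_fin mulr_ge0// sqr_ge0.
    - by apply/measurable_EFinP; exact: measurable_funM.
  have fin : (\int[leb4]_(x in Omega) (lO * e x ^+ 2)%:E)%E \is a fin_num.
    apply: (integrable_fin_num mO); apply: (integrableZ_EFin mO).
    exact: integrable_sqr.
  by rewrite -[leRHS]adde0 leeD2lE.
move=> H0; apply: ne; move: H0 vp; apply: filterS2 => x H0 vx Ox.
have /eqP := H0 Ox; rewrite mulf_eq0 (gt_eqF (mulr_gt0 _ _))//=.
  by rewrite sqrf_eq0 => /eqP.
by rewrite exprn_gt0// vx.
Qed.

End NoPositiveSolution.

Theorem theorem1p5 (R : realType) (Omega : set (R4 R))
    (lambda1 lambda2 theta1 theta2 mu1 mu2 beta lambda1_Omega : R)
    (hOmega : bounded_smooth_domain Omega)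
    (hmu1 : 0 < mu1) (hmu2 : 0 < mu2)
    (hlambda : first_dirichlet_eigenvalue Omega lambda1_Omega)
    (hSigma : Sigma2 lambda1_Omega (lambda1, mu1, theta1) \/
              Sigma2 lambda1_Omega (lambda2, mu2, theta2))
    (hbeta : 0 < beta) :
  ~ exists u v : R4 R -> R,
      [/\ system_solution Omega lambda1 lambda2 mu1 mu2 theta1 theta2 beta u v,
          positive_in Omega u & positive_in Omega v].
Proof.
move=> [u [v [[su sv] up vp]]]; have [ev _] := hlambda.
have [_ [[[[mu _] _] _] _]] := su; have [_ [[[[mv _] _] _] _]] := sv.
case: hSigma => hS.
  exact: (no_positive_solution hOmega ev hbeta hS su mv up vp).
exact: (no_positive_solution hOmega ev hbeta hS sv mu vp up).
Qed.
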